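(* Let $\omega:\mathbb{R}^+\to\mathbb{R}^+$ be a function such that $\omega(t)/t$ is concave and $\sum_{n\ge1}\frac{1}{\omega(n)}=\infty$. Then there exists a trigonometric series $\sum_{n\in\mathbb{Z}}c(n)e^{int}$ with not all $c(n)$ zero, whose symmetric partial sums converge to $0$ for almost every $t\in\mathbb{T}$, and such that $c(n)=O\big(e^{-\omega(\log|n|)}\big)$ for $n<0$.
   Context: $\mathbb{T}=\mathbb{R}/2\pi\mathbb{Z}$; symmetric partial sums are $\sum_{|n|\le N}c(n)e^{int}$. *)

(* Defs.v *)
From HB Require Import structures.
From mathcomp Require Import all_boot all_order all_algebra.
From mathcomp Require Import all_classical all_reals all_analysis.
Set Implicit Arguments. Unset Strict Implicit. Unset Printing Implicit Defensive.
Import Order.TTheory GRing.Theory Num.Theory.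
Local Open Scope ring_scope.

Definition concave_on_pos (R : realType) (g : R -> R) : Prop :=
  forall x y l : R, 0 < x -> 0 < y -> 0 <= l -> l <= 1 ->
    l * g x + (1 - l) * g y <= g (l * x + (1 - l) * y).

(* A complex coefficient sequence c : Z -> C is encoded by its real and
   imaginary parts: c(n) = a n + i * b n.  Then
   c(n) e^{int} = (a n cos nt - b n sin nt) + i (a n sin nt + b n cos nt). *)

Definition psum_re (R : realType) (a b : int -> R) (N : nat) (t : R) : R :=
  \sum_(k < (N.*2).+1)
     (let n : int := (k%:Z - N%:Z)%R in
      a n * cos (n%:~R * t) - b n * sin (n%:~R * t)).

Definition psum_im (R : realType) (a b : int -> R) (N : nat) (t : R) : R :=
  \sum_(k < (N.*2).+1)
     (let n : int := (k%:Z - N%:Z)%R in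
      a n * sin (n%:~R * t) + b n * cos (n%:~R * t)).

Definition cmod (R : realType) (a b : int -> R) (n : int) : R :=
  Num.sqrt (a n ^+ 2 + b n ^+ 2).

(* Main.v *)
Require Import Defs.
From HB Require Import structures.
From mathcomp Require Import all_boot all_order all_algebra.
From mathcomp Require Import all_classical all_reals all_analysis.
From mathcomp Require Import complex ring lra zify.
Set Implicit Arguments. Unset Strict Implicit. Unset Printing Implicit Defensive.
Import Order.TTheory GRing.Theory Num.Theory.
Import numFieldNormedType.Exports.
Local Open Scope ring_scope.

(* Put h(t) = omega(t)/t.  The series is the formal limit of an infinite product
   of trigonometric polynomials p_{k+1} = p_k g_k phi_k(z^lam_k), with
   superlacunary frequencies lam_k = 2^(e_k), e_k growing geometrically.

   The factor phi_k is an analytic polynomial with constant term 1.  On a set of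
   density about 1/h(e_{k+1}) it is as small as e^(-omega(e_{k+1})), and it is at most
   lam_k^4 elsewhere: this is the best that Jensen's inequality allows.  Such a
   polynomial is a power of a truncation of (1 - z)/(1 - r z).  It is then
   spread over many short arcs with quadratic phases; Gauss sums make all its
   coefficients but the constant one tend to 0, hence also those of the series.

   Once p_k is tiny near a point, the gate g_k, a trigonometric polynomial that
   is nearly 0 where p_k is tiny and nearly 1 elsewhere, keeps the product tiny
   at all later stages.  Since g_k differs from 1 only where p_k is tiny,
   inserting it changes each coefficient by very little, and these changes are
   the only source of negative frequencies: c(-n) = O(e^(-omega(log n))).

   The sets where the successive factors are small are nearly independent and,
   by Cauchy condensation, the sum of their densities is infinite, like
   that of 1/omega(n).  So almost every point is eventually killed, and there
   the partial sums tend to 0: full blocks contribute a multiple of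
   the tiny p_k, the last incomplete block a small coefficient of phi_k times a
   bounded partial sum of the previous stage. *)

(** * Complex modulus and points of modulus one *)

Section ComplexModulus.
Variable R : rcfType.
Implicit Types (x y z w v : R[i]) (p q : {poly R[i]}).
Local Notation abs := (@Normc.normc R).

Lemma abs_ge0 z : 0 <= abs z.
Proof. by case: z => a b; rewrite /= sqrtr_ge0. Qed.

Lemma absM x y : abs (x * y) = abs x * abs y.
Proof. exact: Normc.normcM. Qed.

Lemma abs0 : abs 0 = 0.
Proof. exact: Normc.normc0. Qed.

Lemma abs1 : abs 1 = 1.
Proof. exact: Normc.normc1. Qed.

Lemma absN x : abs (- x) = abs x.
Proof. exact: normcN. Qed.

Lemma absD x y : abs (x + y) <= abs x + abs y.
Proof. exact: le_normcD. Qed.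

Lemma absB x y : abs (x - y) = abs (y - x).
Proof. by rewrite -absN opprB. Qed.

Lemma abs_tri x y z : abs (x - z) <= abs (x - y) + abs (y - z).
Proof. by rewrite -[x - z](subrKA y) absD. Qed.

Lemma absBle x y : abs x - abs y <= abs (x - y).
Proof. by rewrite lerBlDr -{1}(subrK y x) absD. Qed.

Lemma absX x n : abs (x ^+ n) = abs x ^+ n.
Proof. by elim: n => [|n IH]; rewrite ?abs1 // !exprS absM IH. Qed.

Lemma absV x : abs x^-1 = (abs x)^-1.
Proof. exact: Normc.normcV. Qed.

Lemma absR (r : R) : abs r%:C%C = `|r|.
Proof. by rewrite /= expr0n /= addr0 sqrtr_sqr. Qed.

Lemma abs_nat n : abs n%:R = n%:R.
Proof. by rewrite -(rmorph_nat (real_complex R)) absR normr_nat. Qed.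

Lemma abs_sum (I : Type) (r : seq I) (P : pred I) (F : I -> R[i]) :
  abs (\sum_(i <- r | P i) F i) <= \sum_(i <- r | P i) abs (F i).
Proof.
elim/big_rec2: _ => [|i u v _ le]; first by rewrite abs0.
by rewrite (le_trans (absD _ _)) // lerD2l.
Qed.

Lemma abs_eq0 z : (abs z == 0) = (z == 0).
Proof.
apply/eqP/eqP => [/Normc.eq0_normc //|->]; exact: abs0.
Qed.

Lemma abs_neq0 z : abs z = 1 -> z != 0.
Proof. by rewrite -abs_eq0 => ->; rewrite oner_neq0. Qed.

Lemma abs_Re z : `|complex.Re z| <= abs z.
Proof.
case: z => a b /=; rewrite -sqrtr_sqr ler_sqrt ?addr_ge0 ?sqr_ge0 //.
by rewrite lerDl sqr_ge0.
Qed.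

Lemma abs_Im z : `|complex.Im z| <= abs z.
Proof.
case: z => a b /=; rewrite -sqrtr_sqr ler_sqrt ?addr_ge0 ?sqr_ge0 //.
by rewrite lerDr sqr_ge0.
Qed.

Lemma abs_sqr z : ((abs z) ^+ 2)%:C%C = z * z^*%C.
Proof.
case: z => a b; rewrite /= sqr_sqrtr ?addr_ge0 ?sqr_ge0 //.
by apply/eqP; rewrite eq_complex /=; apply/andP; split; apply/eqP; ring.
Qed.

Lemma conj_unit z : abs z = 1 -> z^*%C = z^-1.
Proof.
move=> z1; apply: (mulfI (abs_neq0 z1)).
by rewrite -abs_sqr z1 expr1n divff ?abs_neq0.
Qed.

Lemma abs_X1 z n : abs z = 1 -> abs (z ^+ n) = 1.
Proof. by move=> z1; rewrite absX z1 expr1n. Qed.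

Lemma abs_unity z n : (0 < n)%N -> z ^+ n = 1 -> abs z = 1.
Proof.
move=> n0 zn; have /eqP := congr1 abs zn; rewrite absX abs1.
by rewrite pexpr_eq1 // ?abs_ge0 // => /eqP.
Qed.

Lemma abs_subX z w n : abs z = 1 -> abs w = 1 ->
  abs (z ^+ n - w ^+ n) <= n%:R * abs (z - w).
Proof.
move=> z1 w1; elim: n => [|n IH]; first by rewrite subrr abs0 mul0r.
have -> : z ^+ n.+1 - w ^+ n.+1 = z * (z ^+ n - w ^+ n) + (z - w) * w ^+ n.
  by rewrite !exprS; ring.
rewrite (le_trans (absD _ _)) // !absM z1 mul1r (abs_X1 _ w1) mulr1.
by rewrite -natr1 mulrDl mul1r lerD2r.
Qed.

(** On the circle the conjugate is the inverse, so |z - w|^2 = 2 - z/w - w/z. This identity turns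
    the real kernel [kern] into a monomial times a polynomial. *)
Lemma unit_circle_parallelogram z w : abs z = 1 -> abs w = 1 ->
  (z + w) ^+ 2 = z * w * (4 - abs (z - w) ^+ 2)%:C%C.
Proof.
move=> z1 w1; rewrite rmorphB /= abs_sqr rmorphB /= !conj_unit //.
have -> : 4%:C%C = 4 :> R[i] by rewrite (rmorph_nat (real_complex R)).
have zn0 := abs_neq0 z1; have wn0 := abs_neq0 w1.
by field; rewrite zn0 wn0.
Qed.

(** * Roots of unity and coefficient extraction *)

Lemma sum_expr_unity (K : idomainType) (z : K) n :
  z ^+ n = 1 -> z != 1 -> \sum_(i < n) z ^+ i = 0.
Proof.
move=> zn z1; have /eqP := subrX1 z n; rewrite zn subrr eq_sym mulf_eq0.
by rewrite subr_eq0 (negPf z1) /= => /eqP.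
Qed.

(* The sum of the z^i - 1, i < n, is -n, while |z^i - 1| <= i |z - 1|. *)
Lemma unity_gap z n : (0 < n)%N -> z ^+ n = 1 -> z != 1 ->
  1 <= n%:R * abs (z - 1).
Proof.
move=> n0 zn z1; have za := abs_unity n0 zn.
have n0R : 0 < n%:R :> R by rewrite ltr0n.
rewrite -(ler_pM2l n0R) mulr1.
have {1}-> : n%:R = abs (\sum_(i < n) (z ^+ i - 1 ^+ i)).
  rewrite big_split /= sum_expr_unity // add0r.
  under eq_bigr do rewrite expr1n.
  by rewrite sumrN sumr_const card_ord absN abs_nat.
apply: le_trans (abs_sum _ _ _) _.
have -> : n%:R * (n%:R * abs (z - 1)) = \sum_(i < n) n%:R * abs (z - 1).
  by rewrite sumr_const card_ord mulr_natl.
apply: ler_sum => i _; apply: le_trans (abs_subX _ za abs1) _.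
by rewrite ler_wpM2r ?abs_ge0 // ler_nat ltnW.
Qed.

Lemma sum_prim_root (K : idomainType) (w : K) n (l : nat) :
  n.-primitive_root w ->
  \sum_(j < n) w ^+ (j * l) = if (n %| l)%N then n%:R else 0.
Proof.
move=> pw; under eq_bigr do rewrite mulnC exprM.
case: ifPn; rewrite (prim_order_dvd pw).
  by move/eqP ->; under eq_bigr do rewrite expr1n; rewrite sumr_const card_ord.
move=> wl; apply: sum_expr_unity; last by [].
by rewrite exprAC (prim_expr_order pw) expr1n.
Qed.

(** Discrete Fourier inversion on the n-th roots of unity; the exponent -i is replaced by n - i to
    stay within the natural numbers. *)
Lemma coef_avg (K : fieldType) (w : K) n (p : {poly K}) i :
  n.-primitive_root w -> (size p <= n)%N -> (i < n)%N ->
  n%:R * p`_i = \sum_(j < n) p.[w ^+ j] * (w ^+ j) ^- i.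
Proof.
move=> pw sp lin.
have w0 : w != 0 by rewrite (prim_root_eq0 pw) -lt0n (leq_ltn_trans _ lin).
under eq_bigr => j _.
  rewrite (horner_coef_wide _ sp) mulr_suml.
  under eq_bigr => l _.
    have -> : p`_l * (w ^+ j) ^+ l / (w ^+ j) ^+ i
            = p`_l * w ^+ (j * (l + (n - i))).
      rewrite -mulrA; congr (_ * _); apply: (mulIf (expf_neq0 i (expf_neq0 j w0))).
      rewrite mulfVK ?expf_neq0 // -!exprM -exprD -mulnDr -addnA subnK ?(ltnW lin) //.
      by rewrite mulnDr exprD [(j * n)%N]mulnC [in X in _ * X]exprM (prim_expr_order pw) expr1n mulr1.
    over.
  over.
rewrite exchange_big /= (bigD1 (Ordinal lin)) //= [X in _ + X]big1 ?addr0 => [|l li].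
  rewrite -mulr_sumr (sum_prim_root _ pw) subnKC ?(ltnW lin) // dvdnn.
  by rewrite mulrC.
rewrite -mulr_sumr (sum_prim_root _ pw) ifF ?mulr0 //.
(* The exponent l + (n - i) lies strictly between 0 and 2n, so n divides it only when l = i. *)
apply/negP => /dvdnP[k hk].
have := ltn_ord l; move: li; rewrite -val_eqE /= => li ll.
by case: k hk => [|[|k]] hk; [lia | lia | nia].
Qed.


Lemma coef_bound (w : R[i]) n p i (B : R) :
  n.-primitive_root w -> (size p <= n)%N ->
  (forall z, abs z = 1 -> abs p.[z] <= B) -> 0 <= B -> abs p`_i <= B.
Proof.
move=> pw sp hB B0; have [lin|ni] := ltnP i n; last first.
  by rewrite nth_default ?abs0 // (leq_trans sp).
have n0R : 0 < n%:R :> R by rewrite ltr0n (leq_ltn_trans _ lin).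
have wa : abs w = 1.
  by apply: (abs_unity _ (prim_expr_order pw)); rewrite (leq_ltn_trans _ lin).
rewrite -(ler_pM2l n0R) -[X in X * _]abs_nat -absM (coef_avg pw) //.
apply: le_trans (abs_sum _ _ _) _.
rewrite mulr_natl -[X in _ *+ X](card_ord n) -sumr_const; apply: ler_sum => j _.
by rewrite absM absV !abs_X1 ?invr1 ?mulr1 ?hB // ?abs_X1.
Qed.

Lemma sum_periodic (V : nmodType) (f : nat -> V) n a :
  (forall i, f (i + n)%N = f i) -> \sum_(i < n) f (i + a)%N = \sum_(i < n) f i.
Proof.
move=> fn; elim: a => [|a IH]; first by under eq_bigr do rewrite addn0.
rewrite -{}IH; case: n fn => [|n] fn; first by rewrite !big_ord0.
rewrite big_ord_recr big_ord_recl /= addrC.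
congr (_ + _); first by rewrite addnS -addSn addnC fn.
by apply: eq_bigr => i _; rewrite /bump /= add1n addSnnS.
Qed.

(** Writing |S|^2 as a double sum and substituting i = j + a leaves, for each a, a geometric sum
    over j that vanishes unless n divides 2ma. At most 2m residues a pass this test, since the
    quotient 2ma/n is below 2m and determines a; each contributes at most n. *)
Lemma gauss_sum_bound (zeta v : R[i]) n m :
  n.-primitive_root zeta -> v ^+ n = 1 -> (0 < m)%N ->
  abs (\sum_(i < n) zeta ^+ (m * i ^ 2) * v ^+ i) ^+ 2 <= (n * m.*2)%:R.
Proof.
move=> pz vn m0; have n0 := prim_order_gt0 pz.
have za : abs zeta = 1 by exact: abs_unity n0 (prim_expr_order pz).
have va : abs v = 1 by exact: abs_unity n0 vn.
pose f (i : nat) := zeta ^+ (m * i ^ 2) * v ^+ i.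
have fa i : abs (f i) = 1 by rewrite absM !abs_X1 // mulr1.
have f0 i : f i != 0 by exact: abs_neq0.
have fper i : f (i + n)%N = f i.
  rewrite /f exprD vn mulr1; congr (_ * _).
  have -> : (m * (i + n) ^ 2 = n * (m * (i.*2 + n)) + m * i ^ 2)%N by nia.
  by rewrite exprD exprM (prim_expr_order pz) expr1n mul1r.
have fD i a : f (i + a)%N = f i * f a * zeta ^+ (i * (m.*2 * a)).
  rewrite /f exprD.
  have -> : (m * (i + a) ^ 2 = m * i ^ 2 + m * a ^ 2 + i * (m.*2 * a))%N by nia.
  by rewrite !exprD; ring.
pose S := \sum_(i < n) f i.
have SE : (abs S ^+ 2)%:C%C =
    \sum_(a < n) f a * (if (n %| m.*2 * a)%N then n%:R else 0).
  rewrite abs_sqr {2}/S rmorph_sum mulr_sumr.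
  under [RHS]eq_bigr do rewrite -(sum_prim_root _ pz) mulr_sumr.
  rewrite exchange_big /=; apply: eq_bigr => j _.
  rewrite conj_unit // /S -(sum_periodic j fper) mulr_suml.
  apply: eq_bigr => i _; rewrite addnC fD; have := f0 j; move: (f j) => y y0.
  by field.
rewrite -/S -(ger0_norm (sqr_ge0 (abs S))) -absR SE.
apply: le_trans (abs_sum _ _ _) _.
under eq_bigr do rewrite absM fa mul1r (fun_if abs) abs_nat abs0.
rewrite -(big_mkcond (fun a : 'I_n => (n %| m.*2 * a)%N)) /= sumr_const.
rewrite -[leLHS]mulr_natr -natrM ler_nat leq_mul2l; apply/orP; right.
pose g (a : 'I_n) : 'I_(m.*2.-1.+1) := inord (m.*2 * a %/ n).
have gE (a : 'I_n) : (g a : nat) = (m.*2 * a %/ n)%N.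
  rewrite /g inordK // prednK ?double_gt0 // ltn_divLR // ltn_mul2l double_gt0 m0.
  by rewrite ltn_ord.
have ginj : {in [pred a : 'I_n | (n %| m.*2 * a)%N] &, injective g}.
  move=> a b; rewrite !inE => ha hb /(congr1 val) /=; rewrite !gE => /eqP.
  rewrite -(eqn_pmul2r n0) !divnK // eqn_pmul2l ?double_gt0 // => /eqP ab.
  exact: val_inj.
rewrite (_ : #|_| = #|[pred a : 'I_n | (n %| m.*2 * a)%N]|); last exact: eq_card.
rewrite -(card_in_image ginj); apply: leq_trans (max_card _) _.
by rewrite card_ord prednK ?double_gt0.
Qed.


(** * Cutoff polynomials *)

(* For |z| = |v| = 1 this is |(z + v) / 2|^(2N), hence z^(-N) times a polynomial in z. *)
Definition kern N z v : R := (1 - abs (z - v) ^+ 2 / 4) ^+ N.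

Definition kern_poly N v : {poly R[i]} := ((4 * v)^-1 *: ('X + v%:P) ^+ 2) ^+ N.

Lemma size_kern_poly N v : (size (kern_poly N v) <= N.*2.+1)%N.
Proof.
apply: leq_trans (size_poly_exp_leq _ _) _; rewrite ltnS -mul2n leq_mul2r.
apply/orP; right; apply: leq_trans (_ : (3.-1 <= _)%N) => //.
rewrite -subn1 leq_subLR; apply: leq_trans (size_scale_leq _ _) _.
by rewrite (leq_trans (size_poly_exp_leq _ _)) // size_XaddC.
Qed.

Lemma kern_polyE N z v : abs z = 1 -> abs v = 1 ->
  (kern_poly N v).[z] = z ^+ N * (kern N z v)%:C%C.
Proof.
move=> z1 v1; rewrite horner_exp hornerZ horner_exp hornerD hornerX hornerC.
rewrite unit_circle_parallelogram // /kern rmorphXn /= -exprMn; congr (_ ^+ N).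
have v0 := abs_neq0 v1; have z0 := abs_neq0 z1.
have -> : 1 - abs (z - v) ^+ 2 / 4 = (4 - abs (z - v) ^+ 2) * 4^-1 by field.
rewrite [in RHS]rmorphM fmorphV /= (rmorph_nat (real_complex R)).
by field.
Qed.

Lemma kern_ge0 N z v : abs z = 1 -> abs v = 1 -> 0 <= kern N z v.
Proof.
move=> z1 v1; apply: exprn_ge0.
have : abs (z - v) <= 2 by rewrite (le_trans (absD _ _)) // absN z1 v1; lra.
by have := abs_ge0 (z - v); nra.
Qed.

Lemma kern_tail N z v r : abs z = 1 -> abs v = 1 -> 0 <= r -> r <= abs (z - v) ->
  kern N z v <= (1 - r ^+ 2 / 4) ^+ N.
Proof.
move=> z1 v1 r0 rz.
have : abs (z - v) <= 2 by rewrite (le_trans (absD _ _)) // absN z1 v1; lra.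
move=> h2; apply: lerXn2r; rewrite ?nnegrE; nra.
Qed.

Lemma kern_refl N z : kern N z z = 1.
Proof. by rewrite /kern subrr abs0 expr0n mul0r subr0 expr1n. Qed.

Lemma kern_rot N z v a : abs a = 1 -> kern N (a * z) (a * v) = kern N z v.
Proof. by move=> a1; rewrite /kern -mulrBr absM a1 mul1r. Qed.

Section Cutoff.
Variables (n N : nat) (w : R[i]).
Hypotheses (pw : n.-primitive_root w) (Nn : (N < n)%N).

Lemma abs_grid j : abs (w ^+ j) = 1.
Proof. by rewrite abs_X1 // (abs_unity _ (prim_expr_order pw)) ?(prim_order_gt0 pw). Qed.

Definition kern_total : R := \sum_(j < n) kern N 1 (w ^+ j).

(** Summing over the grid kills every coefficient whose index does not differ from N by a multiple
    of n; as N < n, only the middle one survives. Hence the kernels centred at the grid points add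
    up to a constant on the circle. *)
Lemma sum_kern_poly : exists c : R[i], \sum_(j < n) kern_poly N (w ^+ j) = c *: 'X^N.
Proof.
exists ((4 ^- N) * 'C(N.*2, N)%:R * n%:R).
have w0 : w != 0 by rewrite (prim_root_eq0 pw) -lt0n (leq_ltn_trans _ Nn).
have E j : kern_poly N (w ^+ j) = \sum_(i < N.*2.+1)
   ((4 ^- N) * 'C(N.*2, i)%:R * w ^+ (j * (i + (n - N)))) *: 'X^(N.*2 - i).
  rewrite /kern_poly exprZn -exprM mul2n exprDn scaler_sumr; apply: eq_bigr => i _.
  rewrite -polyC_exp [_ * _%:P]mulrC mul_polyC -[_ *+ 'C(_, _)]scaler_nat !scalerA; congr (_ *: _).
  have -> : w ^+ (j * (i + (n - N))) = (w ^+ j) ^+ i / (w ^+ j) ^+ N.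
    apply: (mulIf (expf_neq0 N (expf_neq0 j w0))); rewrite mulfVK ?expf_neq0 //.
    rewrite -!exprM -exprD -mulnDr -addnA subnK ?(ltnW Nn) // mulnDr exprD.
    by rewrite [(j * n)%N]mulnC [in X in _ * X]exprM (prim_expr_order pw) expr1n mulr1.
  by rewrite invfM exprMn !exprVn; ring.
under eq_bigr do rewrite E.
have lN : (N < N.*2.+1)%N by lia.
rewrite exchange_big /= (bigD1 (Ordinal lN)) //= [X in _ + X]big1 ?addr0 => [|l li].
  rewrite -scaler_suml -mulr_sumr (sum_prim_root _ pw) subnKC ?(ltnW Nn) // dvdnn.
  by congr (_ *: 'X^_); lia.
rewrite -scaler_suml -mulr_sumr (sum_prim_root _ pw) ifF ?mulr0 ?scale0r //.
apply/negP => /dvdnP[k hk].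
have := ltn_ord l; move: li; rewrite -val_eqE /= => li ll.
by case: k hk => [|[|k]] hk; [lia | lia | nia].
Qed.

Lemma sum_kern z : abs z = 1 -> \sum_(j < n) kern N z (w ^+ j) = kern_total.
Proof.
have [c hc] := sum_kern_poly.
have E y : abs y = 1 -> (\sum_(j < n) kern N y (w ^+ j))%:C%C = c.
  move=> y1; have /(congr1 (fun p => p.[y])) := hc.
  rewrite horner_sum hornerZ hornerXn.
  under eq_bigr do rewrite kern_polyE ?abs_grid //.
  rewrite -mulr_sumr [RHS]mulrC -rmorph_sum => /mulfI -> //.
  by rewrite expf_neq0 // abs_neq0.
by move=> z1; apply: (@complexI R); rewrite E // /kern_total E ?abs1.
Qed.

Lemma kern_total_ge1 : 1 <= kern_total.
Proof.
have n0 : (0 < n)%N by exact: prim_order_gt0 pw.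
rewrite /kern_total (bigD1 (Ordinal n0)) //= expr0 kern_refl lerDl.
by apply: sumr_ge0 => j _; rewrite kern_ge0 ?abs1 ?abs_grid.
Qed.

(** A smoothed indicator of J: the normalised share of the kernels centred at grid points in J. *)
Definition cutoff (J : pred R[i]) z : R :=
  kern_total^-1 * \sum_(j < n | J (w ^+ j)) kern N z (w ^+ j).

Definition cutoff_poly (J : pred R[i]) : {poly R[i]} :=
  (kern_total^-1)%:C%C *: \sum_(j < n | J (w ^+ j)) kern_poly N (w ^+ j).

Lemma size_cutoff_poly J : (size (cutoff_poly J) <= N.*2.+1)%N.
Proof.
apply: leq_trans (size_scale_leq _ _) _.
apply: leq_trans (size_sum _ _ _) _; apply/bigmax_leqP => j _.
exact: size_kern_poly.
Qed.

Lemma cutoff_polyE J z : abs z = 1 ->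
  (cutoff_poly J).[z] = z ^+ N * (cutoff J z)%:C%C.
Proof.
move=> z1; rewrite hornerZ horner_sum.
under eq_bigr do rewrite kern_polyE ?abs_grid //.
by rewrite -mulr_sumr -rmorph_sum mulrCA -rmorphM.
Qed.

Lemma cutoff_ge0 J z : abs z = 1 -> 0 <= cutoff J z.
Proof.
move=> z1; apply: mulr_ge0; first by rewrite invr_ge0 (le_trans ler01) ?kern_total_ge1.
by apply: sumr_ge0 => j _; rewrite kern_ge0 ?abs_grid.
Qed.

Lemma cutoffT z : abs z = 1 -> cutoff predT z = 1.
Proof.
move=> z1; rewrite /cutoff sum_kern // mulVf // gt_eqF //.
by rewrite (lt_le_trans ltr01) ?kern_total_ge1.
Qed.

Lemma cutoffC J z : abs z = 1 -> 1 - cutoff J z = cutoff (predC J) z.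
Proof.
move=> z1; rewrite -(cutoffT z1) /cutoff.
by rewrite -mulrBr [X in X - _](bigID (fun j : 'I_n => J (w ^+ j))) /= addrAC subrr add0r.
Qed.

Lemma cutoff_le1 J z : abs z = 1 -> cutoff J z <= 1.
Proof. by move=> z1; rewrite -subr_ge0 cutoffC // cutoff_ge0. Qed.

Lemma cutoff_tail (J : pred R[i]) z r : abs z = 1 -> 0 <= r <= 2 ->
  (forall v, abs v = 1 -> J v -> r <= abs (z - v)) ->
  cutoff J z <= n%:R * (1 - r ^+ 2 / 4) ^+ N.
Proof.
move=> z1 /andP[r0 r2] hJ; have c1 := kern_total_ge1.
have q0 : 0 <= (1 - r ^+ 2 / 4) ^+ N by apply: exprn_ge0; nra.
have le1 : kern_total^-1 <= 1 by rewrite invf_le1 // (lt_le_trans ltr01).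
apply: le_trans (_ : \sum_(j < n | J (w ^+ j)) kern N z (w ^+ j) <= _).
  by rewrite ler_piMl //; apply: sumr_ge0 => j _; rewrite kern_ge0 ?abs_grid.
rewrite mulr_natl -[X in _ *+ X](card_ord n) -sumr_const big_mkcond /=.
apply: ler_sum => j _; case: ifP => // Jj.
by apply: kern_tail; rewrite ?abs_grid // hJ ?abs_grid.
Qed.

Lemma cutoff_disjoint (m : nat) (J : 'I_m -> pred R[i]) z : abs z = 1 ->
  (forall v i i', abs v = 1 -> J i v -> J i' v -> i = i') ->
  \sum_(i < m) cutoff (J i) z <= 1.
Proof.
move=> z1 dJ; rewrite -(cutoffT z1) /cutoff -mulr_sumr.
apply: ler_wpM2l; first by rewrite invr_ge0 (le_trans ler01) ?kern_total_ge1.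
under eq_bigr do rewrite big_mkcond.
rewrite exchange_big /=; apply: ler_sum => j _.
have k0 : 0 <= kern N z (w ^+ j) by rewrite kern_ge0 ?abs_grid.
have [i Ji|nJ] := pickP (fun i => J i (w ^+ j)); last first.
  by rewrite big1 // => i _; rewrite nJ.
rewrite (bigD1 i) //= Ji big1 ?addr0 // => i' ii'; case: ifP => // Ji'.
by rewrite (dJ _ _ _ (abs_grid j) Ji' Ji) eqxx in ii'.
Qed.

End Cutoff.

(** * Lacunary products *)

Lemma coef_blocks (K : nzRingType) (a : nat -> {poly K}) d lam j :
  (0 < lam)%N -> (forall m, (size (a m) <= lam)%N) ->
  (\sum_(m < d) 'X^(m * lam) * a m)`_j =
    if (j %/ lam < d)%N then (a (j %/ lam)%N)`_(j %% lam) else 0.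
Proof.
move=> lam0 sa; rewrite coef_sum.
have E m : ('X^(m * lam) * a m)`_j =
    if (m == j %/ lam)%N then (a (j %/ lam)%N)`_(j %% lam) else 0.
  rewrite coefXnM; case: eqVneq => [->|mj].
    rewrite ltnNge leq_trunc_div /=; congr (_`_ _).
    by rewrite {1}(divn_eq j lam) addKn.
  case: ltnP => // le; apply: nth_default; apply: leq_trans (sa m) _.
  rewrite leq_subRL // -mulSnr -leq_divRL // ltn_neqAle mj.
  by rewrite leq_divRL.
under eq_bigr do rewrite E.
case: ltnP => [lt|ge]; last first.
  by rewrite big1 // => m _; rewrite ltn_eqF // (leq_trans (ltn_ord m)).
rewrite (bigD1 (Ordinal lt)) //= eqxx big1 ?addr0 // => m.
by rewrite -val_eqE /= => /negPf ->.
Qed.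

Lemma comp_polyXn_blocks (K : comNzRingType) (phi T : {poly K}) lam :
  T * (phi \Po 'X^lam) = \sum_(m < size phi) 'X^(m * lam) * (phi`_m *: T).
Proof.
rewrite comp_polyE mulr_sumr; apply: eq_bigr => m _.
by rewrite -exprM [(lam * m)%N]mulnC -!scalerAr mulrC.
Qed.

(** The copies of T shifted by multiples of lam do not overlap: the quotient of j by lam selects the
    coefficient of phi, the remainder that of T. *)
Lemma coef_lacunary (K : comNzRingType) (phi T : {poly K}) lam j :
  (0 < lam)%N -> (size T <= lam)%N ->
  (T * (phi \Po 'X^lam))`_j = phi`_(j %/ lam) * T`_(j %% lam).
Proof.
move=> lam0 sT; rewrite comp_polyXn_blocks.
rewrite (coef_blocks (a := fun m => phi`_m *: T)) //; last first.
  by move=> m; apply: leq_trans (size_scale_leq _ _) _.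
rewrite coefZ; case: ltnP => // ge.
by rewrite [phi`_(j %/ lam)]nth_default // mul0r.
Qed.

Lemma size_lacunary (K : idomainType) (phi T : {poly K}) lam :
  (0 < lam)%N -> (size T <= lam)%N -> 
  (size (T * (phi \Po 'X^lam))%R <= size phi * lam)%N.
Proof.
move=> lam0 sT; apply/leq_sizeP => j hj; rewrite coef_lacunary //.
by rewrite nth_default ?mul0r // leq_divRL.
Qed.

Definition partial_sum (p : {poly R[i]}) J z := \sum_(j < J) p`_j * z ^+ j.

Lemma sum_ord_blocks (V : nmodType) (F : nat -> V) m lam r :
  \sum_(j < m * lam + r) F j =
  \sum_(k < m) \sum_(i < lam) F (k * lam + i)%N + \sum_(i < r) F (m * lam + i)%N.
Proof.
elim: m r => [|m IH] r; first by rewrite big_ord0 add0r; apply: eq_bigr.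
rewrite big_ord_recr /= -addrA mulSnr -addnA IH; congr (_ + _).
rewrite big_split_ord /=; congr (_ + _).
by apply: eq_bigr => i _; rewrite addnA.
Qed.

(** The complete blocks sum up to T(z) times a partial sum of phi at z^lam; the interrupted block
    leaves one coefficient of phi times a partial sum of T. *)
Lemma partial_sum_lacunary (phi T : {poly R[i]}) lam J z :
  (0 < lam)%N -> (size T <= lam)%N ->
  partial_sum (T * (phi \Po 'X^lam)) J z =
    partial_sum phi (J %/ lam) (z ^+ lam) * T.[z]
    + phi`_(J %/ lam) * z ^+ (J %/ lam * lam) * partial_sum T (J %% lam) z.
Proof.
move=> lam0 sT; rewrite [in LHS](divn_eq J lam) /partial_sum.
rewrite (sum_ord_blocks (fun j => (T * (phi \Po 'X^lam))`_j * z ^+ j)).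
have E k (i : nat) : (i < lam)%N -> (T * (phi \Po 'X^lam))`_(k * lam + i) * z ^+ (k * lam + i)
    = phi`_k * z ^+ (k * lam) * (T`_i * z ^+ i).
  move=> ilam; rewrite coef_lacunary // divnMDl // divn_small // addn0.
  by rewrite modnMDl modn_small // exprD; ring.
congr (_ + _).
  rewrite mulr_suml; apply: eq_bigr => k _.
  rewrite (horner_coef_wide z sT) -exprM [(lam * k)%N]mulnC mulr_sumr.
  by apply: eq_bigr => i _; rewrite E.
rewrite mulr_sumr; apply: eq_bigr => i _; rewrite E //.
by rewrite (leq_trans (ltn_ord i)) // ltnW // ltn_mod.
Qed.

Lemma abs_partial_sum (p : {poly R[i]}) J z (B : R) : abs z = 1 ->
  (forall j, (j < J)%N -> abs p`_j <= B) -> abs (partial_sum p J z) <= J%:R * B.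
Proof.
move=> z1 hB; apply: le_trans (abs_sum _ _ _) _.
rewrite mulr_natl -[X in _ *+ X](card_ord J) -sumr_const; apply: ler_sum => j _.
by rewrite absM abs_X1 // mulr1 hB.
Qed.

(** * The dip polynomial *)

Lemma expr_1subV_le (s : nat) : (0 < s)%N -> (1 - s%:R^-1) ^+ s <= 2^-1 :> R.
Proof.
case: s => // -[|s] _; first by rewrite invr1 subrr expr1; lra.
have s0 : 0 < s.+1%:R :> R by rewrite ltr0n.
have ss0 : 0 < s.+2%:R :> R by rewrite ltr0n.
have -> : 1 - s.+2%:R^-1 = (1 + s.+1%:R^-1)^-1 :> R.
  have e : s.+2%:R = s.+1%:R + 1 :> R by rewrite natr1.
  rewrite e in ss0 *; field.
  by have := ler0n R s; rewrite !lt0r_neq0 //; lra.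
have i0 : 0 < s.+1%:R^-1 :> R by rewrite invr_gt0.
have i1 : 0 < 1 + s.+1%:R^-1 :> R by rewrite addr_gt0.
rewrite exprVn lef_pV2 ?posrE ?exprn_gt0 //.
have : forall k, 1 + k%:R * s.+1%:R^-1 <= (1 + s.+1%:R^-1) ^+ k :> R.
  elim=> [|k IH]; first by rewrite mul0r addr0 expr0.
  rewrite exprS -natr1; have : 0 <= k%:R :> R by []. 
  move: IH i0; set a := s.+1%:R^-1; set b := _ ^+ k; set c := k%:R; nra.
move/(_ s.+2); apply: le_trans.
have -> : s.+2%:R = s.+1%:R + 1 :> R by rewrite natr1.
by rewrite mulrDl divff ?gt_eqF // mul1r; move: i0; move: (_^-1) => t; lra.
Qed.

Lemma natr_le_exp2 (n : nat) : n%:R <= 2 ^+ n :> R.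
Proof. by rewrite -natrX ler_nat ltnW // ltn_expl. Qed.

Lemma expr_1subV_le_inv (s : nat) : (0 < s)%N -> (1 - s%:R^-1) ^+ (s * s) <= s%:R^-1 :> R.
Proof.
move=> s0; have s0R : 0 < s%:R :> R by rewrite ltr0n.
have : 0 <= 1 - s%:R^-1 :> R by rewrite subr_ge0 invf_le1 // ler1n.
move=> h0; rewrite exprM.
apply: le_trans (_ : (2^-1) ^+ s <= _).
  by apply: lerXn2r; rewrite ?nnegrE ?exprn_ge0 ?invr_ge0 ?expr_1subV_le.
rewrite exprVn lef_pV2 ?posrE ?exprn_gt0 //; exact: natr_le_exp2.
Qed.

Section Dip.
Variable s : nat.
Hypothesis s4 : (4 <= s)%N.
Let r : R := 1 - s%:R^-1.

(* The Taylor truncation of (1 - z) / (1 - r z). *)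
Definition dip_poly : {poly R[i]} :=
  1 - \sum_(m < s * s) (s%:R^-1 * r ^+ m)%:C%C *: 'X^(m.+1).

Let s0 : 0 < s%:R :> R. Proof. by rewrite ltr0n; case: s s4. Qed.
Let s4R : 4 <= s%:R :> R. Proof. by rewrite ler_nat. Qed.
Let sV : s%:R^-1 <= 4^-1 :> R. Proof. by rewrite lef_pV2 ?posrE. Qed.
Let sV0 : 0 < s%:R^-1 :> R. Proof. by rewrite invr_gt0. Qed.

Let r01 : 0 <= r <= 1.
Proof. by rewrite /r; move: sV sV0; move: (s%:R^-1) => t; lra. Qed.
Let r0 : 0 <= r. Proof. by case/andP: r01. Qed.

Lemma dip_poly0 : dip_poly`_0 = 1.
Proof.
rewrite coefB coef1 coef_sum big1 ?subr0 // => m _.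
by rewrite coefZ coefXn mulr0.
Qed.

Lemma size_dip_poly : (size dip_poly <= (s * s).+1)%N.
Proof.
apply/leq_sizeP => j hj; rewrite coefB coef1 gtn_eqF ?(leq_trans _ hj) // sub0r.
rewrite coef_sum big1 ?oppr0 // => m _; rewrite coefZ coefXn gtn_eqF ?mulr0 //.
by apply: leq_trans hj; rewrite ltnS.
Qed.

(** Multiplying by 1 - rz telescopes the truncated geometric series. The last term is the truncation
    error, at most 1/s^2 on the circle by [expr_1subV_le_inv]. *)
Lemma dip_polyM z : (1 - r%:C%C * z) * dip_poly.[z] =
  1 - z + (s%:R^-1 * r ^+ (s * s))%:C%C * z ^+ (s * s).+1.
Proof.
rewrite hornerD hornerN horner_sum hornerE; move: (s * s)%N => D.
elim: D => [|D IH].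
  rewrite big_ord0 subr0 mulr1 expr0 mulr1 expr1 /r rmorphB rmorph1 /=; ring.
rewrite big_ord_recr /= opprD addrA mulrDr IH hornerZ hornerXn !exprS !rmorphM /= /r.
rewrite rmorphB rmorph1 /=; ring.
Qed.

Lemma dip_den z : abs z = 1 -> s%:R^-1 <= abs (1 - r%:C%C * z).
Proof.
move=> z1; apply: le_trans (absBle _ _); by rewrite abs1 absM z1 mulr1 absR ger0_norm // /r opprB addrC subrK.
Qed.

(** The quotient |1 - z| / |1 - rz| is largest at z = -1, where it equals 2/(1 + r): the difference
    of the squares is 2 (1 - r)^2 (1 + Re z). *)
Lemma dip_ratio z : abs z = 1 -> abs (1 - z) * (1 + r) <= 2 * abs (1 - r%:C%C * z).
Proof.
move=> z1.
rewrite -(@ler_pXn2r _ 2) ?nnegrE ?mulr_ge0 ?abs_ge0 //; last by case/andP: r01; move: r => t; lra.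
rewrite !exprMn; case: z z1 => a b; rewrite /= => z1.
have ab : a ^+ 2 + b ^+ 2 = 1.
  by rewrite -[LHS]sqr_sqrtr ?addr_ge0 ?sqr_ge0 // z1 expr1n.
rewrite !sqr_sqrtr ?addr_ge0 ?sqr_ge0 //.
have a1 : 0 <= 1 + a by nra.
rewrite -subr_ge0 (_ : _ - _ = 2 * (1 - r) ^+ 2 * (1 + a)
    + (4 * r ^+ 2 - (1 + r) ^+ 2) * (a ^+ 2 + b ^+ 2 - 1)); last by ring.
rewrite ab subrr mulr0 addr0; apply: mulr_ge0 => //.
by apply: mulr_ge0; rewrite ?sqr_ge0.
Qed.

(** With t = 1/s, |1 - z| is at most (1 + t)|1 - rz| and the truncation error t^2 at most t|1 - rz|;
    dividing by |1 - rz| gives 1 + 2t. *)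
Lemma dip_bound z : abs z = 1 -> abs dip_poly.[z] <= 1 + 2 / s%:R.
Proof.
move=> z1; have d := dip_den z1; have q := dip_ratio z1.
have e := congr1 abs (dip_polyM z); rewrite absM in e.
have h : abs (1 - r%:C%C * z) * abs dip_poly.[z]
   <= abs (1 - z) + s%:R^-1 * s%:R^-1.
  rewrite e; apply: le_trans (absD _ _) _; rewrite lerD2l absM abs_X1 // mulr1 absR.
  rewrite ger0_norm ?mulr_ge0 ?exprn_ge0 ?(ltW sV0) //.
  by rewrite ler_wpM2l ?expr_1subV_le_inv ?(ltW sV0) //; case: s s4.
have r1 : r = 1 - s%:R^-1 by []. 
move: h d q sV sV0 (abs_ge0 dip_poly.[z]) (abs_ge0 (1 - z)); rewrite r1.
set A := abs (1 - _ * z); set B := abs dip_poly.[z]; set t := s%:R^-1; set E := abs (1 - z).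
move=> h d q tV t0 B0 E0; rewrite leNgt; apply/negP => hB.
have h1 : A * (1 + 2 * t) < A * B by rewrite ltr_pM2l //; lra.
have h2 : A * (1 + 2 * t) < E + t * t by lra.
have hE : E <= A * (1 + t).
  have p : 0 < 2 - t by lra.
  have : 0 <= A * (t * (1 - t)).
    by apply: mulr_ge0; [lra | apply: mulr_ge0; lra].
  by rewrite -(ler_pM2r p); nra.
nra.
Qed.

(** The numerator is at most 1/(2s) + 1/s^2, hence at most 3/(4s) as s >= 4, and |1 - rz| is at
    least 1/s. A high power will make this dip deep. *)
Lemma dip_near z : abs z = 1 -> abs (z - 1) <= s%:R^-1 / 2 -> abs dip_poly.[z] <= 3 / 4.
Proof.
move=> z1 hz; have d := dip_den z1; rewrite absB in hz.
have e := congr1 abs (dip_polyM z); rewrite absM in e.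
have h : abs (1 - r%:C%C * z) * abs dip_poly.[z]
   <= abs (1 - z) + s%:R^-1 * s%:R^-1.
  rewrite e; apply: le_trans (absD _ _) _; rewrite lerD2l absM abs_X1 // mulr1 absR.
  rewrite ger0_norm ?mulr_ge0 ?exprn_ge0 ?(ltW sV0) //.
  by rewrite ler_wpM2l ?expr_1subV_le_inv ?(ltW sV0) //; case: s s4.
move: h d hz sV sV0 (abs_ge0 dip_poly.[z]).
set A := abs (1 - _ * z); set B := abs dip_poly.[z]; set t := s%:R^-1; set E := abs (1 - z).
move=> h d q tV t0 B0; rewrite leNgt; apply/negP => hB.
nra.
Qed.

End Dip.

(** * The factor of one stage *)

(* On the arc around zeta^I the factor looks like Q(zeta^(I^2) y^nu).  The phases
   zeta^(m I^2) turn the sum over I in the coefficients of the m-th block into a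
   Gauss sum, which gains a factor sqrt M. *)

Section Factor.
Variables (M N n nu d : nat) (w : R[i]) (Q : {poly R[i]}) (K : R).
Hypotheses (M0 : (0 < M)%N) (pw : n.-primitive_root w) (Mn : (M %| n)%N).
Hypotheses (Nn : (N.*2.+1 <= n)%N) (Nnu : (N.*2.+1 <= nu)%N).
Hypotheses (Q0 : Q`_0 = 1) (sQ : (size Q <= d.+1)%N).
Hypothesis QK : forall z, abs z = 1 -> abs Q.[z] <= K.

Let zeta := w ^+ (n %/ M).

Let n0 : (0 < n)%N. Proof. exact: prim_order_gt0 pw. Qed.

Hypotheses (K1 : 1 <= K) (dn : (d < n)%N).

Let pz : M.-primitive_root zeta. Proof. exact: dvdn_prim_root. Qed.
Let Nn' : (N < n)%N. Proof. by clear - Nn; lia. Qed.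
Let za : abs zeta = 1. Proof. exact: abs_unity M0 (prim_expr_order pz). Qed.
Let M0R : 0 < M%:R :> R. Proof. by rewrite ltr0n. Qed.

Let zXM I : (zeta ^+ I) ^+ M = 1.
Proof. by rewrite -exprM mulnC exprM (prim_expr_order pz) expr1n. Qed.
Let aQ I y : abs y = 1 -> abs (zeta ^+ I * y ^+ nu) = 1.
Proof. by move=> y1; rewrite absM (abs_X1 _ za) (abs_X1 _ y1) mulr1. Qed.

Definition arc (I : nat) : pred R[i] :=
  fun v => abs (v - zeta ^+ I) <= (4 * M%:R)^-1.

Definition arc_bump (I : nat) z : R := cutoff n N w (arc I) z.

(** Distinct M-th roots of unity are at least 1/M apart, while the centres of two arcs with a common
    point are at most 1/(2M) apart. *)
Lemma arc_disjoint v I I' : (I < M)%N -> (I' < M)%N -> arc I v -> arc I' v -> I = I'.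
Proof.
move=> IM IM' a a'; apply/eqP; apply: contraT => II'.
have zI : zeta ^+ I' != 0 by rewrite abs_neq0 // abs_X1.
have r1 : zeta ^+ I / zeta ^+ I' != 1.
  apply: contra II' => /eqP e.
  have : zeta ^+ I == zeta ^+ I' by rewrite -(divfK zI (zeta ^+ I)) e mul1r.
  by rewrite (eq_prim_root_expr pz) !modn_small.
have rM : (zeta ^+ I / zeta ^+ I') ^+ M = 1.
  by rewrite expr_div_n !zXM divff ?oner_neq0.
have := unity_gap M0 rM r1.
have -> : zeta ^+ I / zeta ^+ I' - 1 = (zeta ^+ I - zeta ^+ I') / zeta ^+ I'.
  by rewrite mulrBl divff.
rewrite absM absV (abs_X1 _ za) invr1 mulr1 => g.
have t := abs_tri (zeta ^+ I) v (zeta ^+ I'); rewrite [abs (_ - v)]absB in t.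
have : abs (zeta ^+ I - zeta ^+ I') <= (4 * M%:R)^-1 + (4 * M%:R)^-1.
  by apply: le_trans t _; apply: lerD.
rewrite -(ler_pM2l M0R); have -> : M%:R * ((4 * M%:R)^-1 + (4 * M%:R)^-1) = 2^-1 :> R.
  by field; rewrite gt_eqF.
lra.
Qed.

Lemma arc_bump_ge0 I z : abs z = 1 -> 0 <= arc_bump I z.
Proof. exact: cutoff_ge0. Qed.

Lemma sum_arc_bump_le1 z : abs z = 1 -> \sum_(I < M) arc_bump I z <= 1.
Proof.
move=> z1; apply: (cutoff_disjoint pw Nn' (J := fun I : 'I_M => arc I)) => //.
by move=> v I I' v1 a a'; apply: val_inj; apply: arc_disjoint a a'.
Qed.

(** As M divides n, multiplication by zeta^I permutes the grid, so the bumps are rotations of one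
    another. *)
Lemma arc_bump_rot I z : abs z = 1 -> arc_bump I z = arc_bump 0 (z / zeta ^+ I).
Proof.
move=> z1; rewrite /arc_bump /cutoff; congr (_ * _).
have zIa : abs (zeta ^+ I) = 1 by rewrite abs_X1.
rewrite big_mkcond [in RHS]big_mkcond /=.
pose f j := if arc I (w ^+ j) then kern N z (w ^+ j) else 0.
rewrite -(@sum_periodic _ f n (n %/ M * I)); last first.
  by move=> i; rewrite /f exprD (prim_expr_order pw) mulr1.
apply: eq_bigr => j _; rewrite /f exprD exprM -/zeta mulrC.
rewrite /arc expr0 -[X in abs (_ - X)]mulr1 -mulrBr absM zIa mul1r.
by rewrite -{1}(divfK (abs_neq0 zIa) z) [_ / _ * _]mulrC kern_rot.
Qed.

Definition arc_bump_poly : {poly R[i]} := cutoff_poly n N w (arc 0).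

(** A coefficient is bounded by the grid average of the bump. The M rotated bumps have equal
    averages and total at most 1, so each average is at most 1/M. *)
Lemma arc_bump_poly_coef l : abs arc_bump_poly`_l <= M%:R^-1.
Proof.
have [ln|nl] := ltnP l n; last first.
  rewrite nth_default ?abs0 ?invr_ge0 ?ler0n //.
  by apply: leq_trans (size_cutoff_poly _ _ _ _) _; apply: leq_trans nl.
have n0R : 0 < n%:R :> R by rewrite ltr0n.
pose S := \sum_(j < n) arc_bump 0 (w ^+ j).
have rotS (I : nat) : \sum_(j < n) arc_bump I (w ^+ j) = S.
  rewrite -(@sum_periodic _ (fun j => arc_bump I (w ^+ j)) n (n %/ M * I)); last first.
    by move=> i; rewrite exprD (prim_expr_order pw) mulr1.
  apply: eq_bigr => j _; rewrite arc_bump_rot ?(abs_grid pw) //; congr (arc_bump _ _).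
  by rewrite exprD exprM -/zeta mulfK // abs_neq0 // abs_X1.
have MS : M%:R * S <= n%:R.
  have -> : M%:R * S = \sum_(I < M) \sum_(j < n) arc_bump I (w ^+ j).
    by under eq_bigr do rewrite rotS; rewrite sumr_const card_ord mulr_natl.
  rewrite exchange_big /= -[leRHS]mulr1 mulr_natl -[X in _ *+ X](card_ord n) -sumr_const.
  by apply: ler_sum => j _; rewrite sum_arc_bump_le1 ?(abs_grid pw).
have nS : n%:R * abs arc_bump_poly`_l <= S.
  rewrite -[X in X * _]abs_nat -absM (coef_avg pw) //; last first.
    exact: leq_trans (size_cutoff_poly _ _ _ _) _.
  apply: le_trans (abs_sum _ _ _) _; apply: ler_sum => j _.
  have wj := abs_grid pw j.
  rewrite (@cutoff_polyE n N w pw) // !absM absV [abs (_ ^+ l)]abs_X1 // [abs (_ ^+ N)]abs_X1 // invr1 mulr1 mul1r.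
  by rewrite absR ger0_norm // arc_bump_ge0.
rewrite -(ler_pM2l n0R) -(ler_pM2l M0R) mulrCA [X in _ <= X]mulrCA divff ?gt_eqF // mulr1.
by rewrite mulrCA; apply: le_trans MS; rewrite ler_pM2l.
Qed.

(** This is z^N times the sum of the bumps weighted by zeta^(m I^2). Rotating a bump by zeta^I
    multiplies its l-th coefficient by zeta^((N - l) I), so the coefficients contain quadratic Gauss
    sums. *)
Definition chirp m : {poly R[i]} := \poly_(l < N.*2.+1)
  (arc_bump_poly`_l * \sum_(I < M) zeta ^+ (m * I ^ 2) * (zeta ^+ N / zeta ^+ l) ^+ I).

Lemma chirpE m z : abs z = 1 ->
  (chirp m).[z] = z ^+ N * \sum_(I < M) zeta ^+ (m * I ^ 2) * (arc_bump I z)%:C%C.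
Proof.
move=> z1; rewrite horner_poly.
under eq_bigr do rewrite mulr_sumr mulr_suml.
rewrite exchange_big mulr_sumr /=; apply: eq_bigr => I _.
have zIa : abs (zeta ^+ I) = 1 by rewrite abs_X1.
have zIn := abs_neq0 zIa.
have q1 : abs (z / zeta ^+ I) = 1 by rewrite absM absV zIa invr1 mulr1.
rewrite arc_bump_rot // mulrCA.
have -> : z ^+ N * (arc_bump 0 (z / zeta ^+ I))%:C%C = (zeta ^+ I) ^+ N * arc_bump_poly.[z / zeta ^+ I].
  rewrite (@cutoff_polyE n N w pw) // expr_div_n -/(arc_bump 0 _).
  by field; rewrite expf_neq0.
rewrite (horner_coef_wide _ (size_cutoff_poly _ _ _ _)) !mulr_sumr.
apply: eq_bigr => l _; rewrite !expr_div_n -!exprM ![(I * _)%N]mulnC; ring.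
Qed.

Lemma chirp_coef m l : (0 < m)%N -> abs (chirp m)`_l ^+ 2 <= m.*2%:R / M%:R.
Proof.
move=> m0; rewrite coef_poly; case: ltnP => _; last first.
  by rewrite abs0 expr0n divr_ge0 ?ler0n.
rewrite absM exprMn.
have v1 : (zeta ^+ N / zeta ^+ l) ^+ M = 1.
  by rewrite expr_div_n !zXM divff ?oner_neq0.
have g := gauss_sum_bound pz v1 m0.
have b : abs arc_bump_poly`_l ^+ 2 <= M%:R^-1 ^+ 2.
  by apply: lerXn2r; rewrite ?nnegrE ?abs_ge0 ?invr_ge0 ?ler0n ?arc_bump_poly_coef.
apply: le_trans (ler_pM _ _ b g) _; rewrite ?exprn_ge0 ?abs_ge0 //.
rewrite natrM le_eqVlt; apply/orP; left; apply/eqP; field; by rewrite gt_eqF.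
Qed.

(** Since [chirp] carries a factor z^N, the offset nu - N attaches the coefficient of degree m + 1
    of Q exactly to y^((m + 1) nu). Blocks have length at most 2N + 1 <= nu, hence do not
    overlap. *)
Definition factor : {poly R[i]} :=
  1 + 'X^(nu - N) * \sum_(m < d) 'X^(m * nu) * (Q`_m.+1 *: chirp m.+1).

Lemma coef_factor j : factor`_j = (j == 0%N)%:R +
  (if (j < nu - N)%N then 0 else
   if ((j - (nu - N)) %/ nu < d)%N
   then Q`_((j - (nu - N)) %/ nu).+1
        * (chirp ((j - (nu - N)) %/ nu).+1)`_((j - (nu - N)) %% nu)
   else 0).
Proof.
rewrite coefD coef1 coefXnM; congr (_ + _); case: ltnP => // _.
rewrite (coef_blocks (a := fun m => Q`_m.+1 *: chirp m.+1)) //.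
- by rewrite coefZ.
- by clear - Nnu; lia.
- move=> m; apply: leq_trans (size_scale_leq _ _) _.
  by apply: leq_trans (size_poly _ _) _.
Qed.

Lemma factor0 : factor`_0 = 1.
Proof. by rewrite coef_factor eqxx ifT ?addr0 //; clear - Nnu; lia. Qed.

Lemma factor_coef j : (0 < j)%N -> abs factor`_j ^+ 2 <= K ^+ 2 * (d.*2%:R / M%:R).
Proof.
move=> j0; rewrite coef_factor gtn_eqF // add0r.
have rhs0 : 0 <= K ^+ 2 * (d.*2%:R / M%:R) by rewrite mulr_ge0 ?sqr_ge0 ?divr_ge0 ?ler0n.
case: ltnP => _; first by rewrite abs0 expr0n.
case: ltnP => [md|_]; last by rewrite abs0 expr0n.
rewrite absM exprMn; apply: ler_pM; rewrite ?sqr_ge0 //.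
  have KK : 0 <= K by apply: le_trans K1.
  apply: lerXn2r; rewrite ?nnegrE ?abs_ge0 //.
  by apply: (coef_bound _ pw) => //; apply: leq_trans sQ _.
apply: le_trans (chirp_coef _ _) _ => //.
by rewrite ler_pM2r ?invr_gt0 // ler_nat leq_double.
Qed.

Lemma size_factor : (size factor <= nu * d.+1)%N.
Proof.
apply/leq_sizeP => j hj; rewrite coef_factor gtn_eqF; last by clear - hj Nnu; nia.
rewrite ifF; last by clear - hj Nnu; nia.
by rewrite ifF ?addr0 // ltnNge leq_divRL; clear - hj Nnu; [nia | lia].
Qed.

(** Because Q has constant term 1, the terms recombine into a convex combination of 1 and the values
    of Q at zeta^(I^2) y^nu, with the bumps as weights. *)
Lemma factorE y : abs y = 1 -> factor.[y] =
  (1 - \sum_(I < M) arc_bump I y)%:C%C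
  + \sum_(I < M) (arc_bump I y)%:C%C * Q.[zeta ^+ (I ^ 2) * y ^+ nu].
Proof.
move=> y1; rewrite hornerD hornerM hornerXn horner_sum hornerE.
have QE x : Q.[x] = 1 + \sum_(m < d) Q`_m.+1 * x ^+ m.+1.
  by rewrite (horner_coef_wide _ sQ) big_ord_recl /= Q0 expr0 mulr1.
under [X in _ = _ + X]eq_bigr do rewrite QE mulrDr mulr1.
rewrite big_split /= rmorphB rmorph1 rmorph_sum /= addrA subrK; congr (_ + _).
under [RHS]eq_bigr do rewrite mulr_sumr.
rewrite exchange_big mulr_sumr /=; apply: eq_bigr => m _.
rewrite hornerM hornerXn hornerZ chirpE // !mulr_sumr; apply: eq_bigr => I _.
have -> : y ^+ (nu - N) * (y ^+ (m * nu) * (Q`_m.+1 * (y ^+ N *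
    (zeta ^+ (m.+1 * I ^ 2) * (arc_bump I y)%:C%C)))) =
  (arc_bump I y)%:C%C * (Q`_m.+1 * (zeta ^+ (m.+1 * I ^ 2) * (y ^+ (nu - N) * y ^+ N * y ^+ (m * nu)))).
  by ring.
rewrite -!exprD subnK; last by clear - Nnu; lia.
by rewrite exprMn -!exprM -mulSn [(I ^ 2 * _)%N]mulnC [(nu * _)%N]mulnC.
Qed.

Lemma factor_le y : abs y = 1 -> abs factor.[y] <= K.
Proof.
move=> y1; rewrite factorE //; have b1 := sum_arc_bump_le1 y1.
apply: le_trans (absD _ _) _; rewrite absR ger0_norm ?subr_ge0 //.
apply: le_trans (lerD (lexx _) (abs_sum _ _ _)) _.
apply: le_trans (_ : 1 - \sum_(I < M) arc_bump I y + \sum_(I < M) arc_bump I y * K <= _).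
  rewrite lerD2l; apply: ler_sum => I _; rewrite absM absR ger0_norm ?arc_bump_ge0 //.
  apply: ler_wpM2l; first exact: arc_bump_ge0.
  by apply: QK; apply: aQ.
rewrite -mulr_suml; move: b1; set S := \sum_(_ < _) _ => b1.
have : 0 <= (1 - S) * (K - 1) by rewrite mulr_ge0 ?subr_ge0.
nra.
Qed.

Lemma arc_bump_near y I : abs y = 1 -> abs (y - zeta ^+ I) <= (8 * M%:R)^-1 ->
  1 - arc_bump I y <= n%:R * (1 - ((8 * M%:R)^-1) ^+ 2 / 4) ^+ N.
Proof.
move=> y1 hy; rewrite /arc_bump (cutoffC pw Nn') //.
have i0 : 0 < M%:R^-1 :> R by rewrite invr_gt0.
have i1 : M%:R^-1 <= 1 :> R by rewrite invf_le1 // ler1n.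
have e8 : (8 * M%:R)^-1 = 8^-1 * M%:R^-1 :> R by rewrite invfM.
have e4 : (4 * M%:R)^-1 = 4^-1 * M%:R^-1 :> R by rewrite invfM.
apply: (@cutoff_tail n N w pw (predC (arc I)) y (8 * M%:R)^-1) => //.
  by rewrite e8; move: i0 i1; move: (M%:R^-1) => t; lra.
move=> v v1; rewrite /= /arc -ltNge => hv.
have t := abs_tri v y (zeta ^+ I); rewrite [abs (v - y)]absB in t.
move: hv hy; rewrite e8 e4; move: i0 t; move: (M%:R^-1) => u i0 t hv hy; lra.
Qed.

(** A point within 1/(8M) of the centre is at distance at least 1/(8M) from the complement of its
    arc. So all the weight outside arc I is a cutoff tail, and it multiplies values of modulus at
    most K. *)
Lemma factor_near y I : (I < M)%N -> abs y = 1 ->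
  abs (y - zeta ^+ I) <= (8 * M%:R)^-1 ->
  abs factor.[y] <= K * (n%:R * (1 - ((8 * M%:R)^-1) ^+ 2 / 4) ^+ N)
    + abs Q.[zeta ^+ (I ^ 2) * y ^+ nu].
Proof.
move=> IM y1 hy; have hb := arc_bump_near y1 hy; rewrite factorE //.
have b1 := sum_arc_bump_le1 y1.
apply: le_trans (absD _ _) _; rewrite absR ger0_norm ?subr_ge0 //.
rewrite [X in abs X](bigD1 (Ordinal IM)) //=.
apply: le_trans (lerD (lexx _) (absD _ _)) _.
rewrite [\sum_(_ < _) arc_bump _ _](bigD1 (Ordinal IM)) //= in b1 *.
have h1 : abs (\sum_(i < M | i != Ordinal IM) (arc_bump i y)%:C%C * Q.[zeta ^+ (i ^ 2) * y ^+ nu])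
   <= (\sum_(i < M | i != Ordinal IM) arc_bump i y) * K.
  apply: le_trans (abs_sum _ _ _) _; rewrite mulr_suml; apply: ler_sum => i _.
  rewrite absM absR ger0_norm ?arc_bump_ge0 //; apply: ler_wpM2l; first exact: arc_bump_ge0.
  by apply: QK; apply: aQ.
have h2 : abs ((arc_bump I y)%:C%C * Q.[zeta ^+ (I ^ 2) * y ^+ nu]) <= abs Q.[zeta ^+ (I ^ 2) * y ^+ nu].
  rewrite absM absR ger0_norm ?arc_bump_ge0 // ler_piMl ?abs_ge0 //.
  exact: cutoff_le1.
have s0 : 0 <= \sum_(i < M | i != Ordinal IM) arc_bump i y.
  by apply: sumr_ge0 => i _; rewrite arc_bump_ge0.
have hK : K * (1 - arc_bump I y) <= K * (n%:R * (1 - ((8 * M%:R)^-1) ^+ 2 / 4) ^+ N).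
  by rewrite ler_wpM2l // (le_trans ler01).
move: h1 h2 s0 hK b1.
set A := abs (\sum_(_ < _ | _) _); set B := abs (_ * _); set q := abs Q.[_].
set S := \sum_(_ < _ | _) _; set X := K * (n%:R * _); set b := arc_bump I y.
move=> h1 h2 s0 hK b1.
have : 0 <= (1 - (b + S)) * (K - 1) by rewrite mulr_ge0 ?subr_ge0.
nra.
Qed.

End Factor.

End ComplexModulus.

(** * Points of the unit circle *)

Section CircleParam.
Variable R : realType.
Local Notation abs := (@Normc.normc R).

Definition expi (t : R) : R[i] := (cos t +i* sin t)%C.

Lemma abs_expi t : abs (expi t) = 1.
Proof. by rewrite /= cos2Dsin2 sqrtr1. Qed.

Lemma expiD s t : expi (s + t) = expi s * expi t.
Proof. by rewrite /expi cosD sinD; apply/eqP; rewrite eq_complex /= eqxx addrC mulrC eq_sym addrC mulrC eqxx. Qed.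

Lemma expi0 : expi 0 = 1.
Proof. by rewrite /expi cos0 sin0. Qed.

Lemma expiX t n : expi t ^+ n = expi (n%:R * t).
Proof.
elim: n => [|n IH]; first by rewrite mul0r expi0.
by rewrite exprS IH -expiD -natr1 mulrDl mul1r addrC.
Qed.

Lemma expi_2piM n : expi (n%:R * (2 * pi)) = 1.
Proof.
rewrite -expiX (_ : expi _ = 1) ?expr1n //.
by rewrite /expi mulr_natl cos2pi sin2pi.
Qed.

Lemma expi_prim n : (0 < n)%N -> n.-primitive_root (expi (2 * pi / n%:R)).
Proof.
move=> n0; have n0R : 0 < n%:R :> R by rewrite ltr0n.
apply/andP; split=> //; apply/forallP => i; rewrite unity_rootE expiX.
have [->|lt] := eqVneq i.+1 n.
  rewrite (_ : n%:R * _ = 1%:R * (2 * pi)) ?expi_2piM ?eqxx //.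
  by field; rewrite gt_eqF.
have {}lt : (i.+1 < n)%N by rewrite ltn_neqAle lt ltn_ord.
apply/eqP; rewrite (negbTE (_ : _ != _)) //.
apply/eqP => /(congr1 (@complex.Re R)) /= c1.
pose a : R := i.+1%:R * pi / n%:R.
have E : i.+1%:R * (2 * pi / n%:R) = a *+ 2 by rewrite /a mulr2n; field; rewrite gt_eqF.
have s0 : 0 < sin a.
  apply: sin_gt0_pi; rewrite divr_gt0 ?mulr_gt0 ?pi_gt0 ?ltr0n //=.
  by rewrite ltr_pdivrMr // mulrC ltr_pM2l ?pi_gt0 // ltr_nat.
move: c1; rewrite E cos_mulr2n cos2sin2.
have := s0; have : 0 < sin a ^+ 2 by rewrite exprn_gt0.
move: (sin a ^+ 2) => x x0 _; rewrite mulr2n; lra.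
Qed.

Lemma sin_ge0_le (y : R) : 0 <= y -> `|sin y| <= y.
Proof.
rewrite le_eqVlt => /predU1P[<-|y0]; first by rewrite sin0 normr0.
have [|c _] := @MVT R sin cos 0 y y0.
  by apply: continuous_subspaceT => x; exact: continuous_sin.
rewrite sin0 !subr0 => ->; rewrite normrM (gtr0_norm y0) ler_piMl ?(ltW y0) //.
exact: cos_max.
Qed.

Lemma abs_sin_le (y : R) : `|sin y| <= `|y|.
Proof.
have [y0|y0] := lerP 0 y; first by rewrite (ger0_norm y0) sin_ge0_le.
by rewrite (ltr0_norm y0) -(opprK y) sinN normrN opprK sin_ge0_le // oppr_ge0 ltW.
Qed.

Lemma expi_lip s t : abs (expi s - expi t) <= `|s - t|.
Proof.
rewrite -(@ler_pXn2r _ 2) ?nnegrE ?abs_ge0 // real_normK ?num_real //.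
have h := abs_sin_le ((s - t) / 2).
have h2 : sin ((s - t) / 2) ^+ 2 <= ((s - t) / 2) ^+ 2.
  by rewrite -[leLHS]real_normK ?num_real // -[leRHS]real_normK ?num_real // ler_sqr ?nnegrE.
have E : cos (s - t) = 1 - 2 * sin ((s - t) / 2) ^+ 2.
  have {1}-> : s - t = ((s - t) / 2) *+ 2 by rewrite mulr2n; field.
  by rewrite cos_mulr2n cos2sin2 mulr2n; ring.
rewrite /= sqr_sqrtr ?addr_ge0 ?sqr_ge0 //.
have -> : (cos s - cos t) ^+ 2 + (sin s - sin t) ^+ 2 = 2 - 2 * cos (s - t).
  rewrite cosB; have := cos2Dsin2 s; have := cos2Dsin2 t.
  move: (cos s) (sin s) (cos t) (sin t) => a b c d h3 h4; nra.
by rewrite E; nra.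
Qed.

End CircleParam.

(** * Lacunary products with gates *)

Section Assembly.
Variable R : realType.
Local Notation abs := (@Normc.normc R).
Implicit Types (z v : R[i]) (q : {poly R[i]}).
Variables (lam N grid : nat -> nat) (w : nat -> R[i]) (phi : nat -> {poly R[i]}).
Variables (eps rad B K eta : nat -> R).

(** The radius given up from one stage to the next. Half of it enters [dead_nbhd], the other half is
    the distance over which the cutoff falls, and [leak] is the resulting bound from
    [cutoff_tail]. *)
Definition gap k : R := rad k - rad k.+1.
Definition leak k : R := (grid k)%:R * (1 - (gap k / 2) ^+ 2 / 4) ^+ N k.
(* The coefficient of index j of [prod_poly k] is the coefficient of frequency
   j - freq_shift k of the trigonometric polynomial. *)
Definition freq_shift k : nat := \sum_(i < k) N i.

Hypothesis pw : forall k, (grid k).-primitive_root (w k).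
Hypothesis Ngrid : forall k, (N k < grid k)%N.
Hypothesis gap_bd : forall k, 0 <= gap k <= 2.
Hypothesis phi0 : forall k, (phi k)`_0 = 1.
Hypothesis phi_coef : forall k m, (0 < m)%N -> abs (phi k)`_m <= eta k.
Hypothesis etaP : forall k, eta k <= 2^-1 ^+ k.
Hypothesis phiK : forall k z, abs z = 1 -> abs (phi k).[z] <= K k.
Hypothesis B0 : 1 <= B 0.
Hypothesis BS : forall k, B k * K k <= B k.+1.
Hypothesis size0 : (1 + (N 0).*2 <= lam 0)%N.
Hypothesis sizeS : forall k, (size (phi k) * lam k + (N k.+1).*2 <= lam k.+1)%N.
Hypothesis freq_shiftP : forall k, ((freq_shift k.+1).*2 < lam k)%N.
Hypothesis N_gt0 : forall k, (0 < N k)%N.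
Hypothesis leak_eps : forall k, B k * leak k <= eps k.
Hypothesis leak_epsS : forall k, B k * leak k * K k <= eps k.+1.
Hypothesis leak_size : forall k, (size (phi k))%:R * (B k * leak k) <= 2^-1 ^+ k.
Hypothesis lam_eps : forall k, (lam k)%:R * eps k <= 2^-1 ^+ k.
Hypothesis epsS : forall k, eps k.+1 <= eps k / 2.
Hypothesis eps0 : eps 0 <= 8^-1.

Definition dead_nbhd k q : pred R[i] := fun v =>
  `[< forall z, abs z = 1 -> abs (z - v) <= gap k / 2 -> abs q.[z] <= eps k >].

Definition gate k q : {poly R[i]} :=
  'X^(N k) - cutoff_poly (grid k) (N k) (w k) (dead_nbhd k q).

Fixpoint prod_poly k : {poly R[i]} :=
  if k is k'.+1 then prod_poly k' * gate k' (prod_poly k') * (phi k' \Po 'X^(lam k')) else 1.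

Definition gated k := prod_poly k * gate k (prod_poly k).
Definition defect k := prod_poly k * (gate k (prod_poly k) - 'X^(N k)).

(** Smallness is required on a whole neighbourhood, with a radius that decreases with k: in this
    form it passes through the next gate. *)
Definition dead k z :=
  forall z', abs z' = 1 -> abs (z' - z) <= rad k -> abs (prod_poly k).[z'] <= eps k.

Lemma size_phi_gt0 k : (0 < size (phi k))%N.
Proof. by case: (posnP (size (phi k))) (phi0 k) => // s0; rewrite nth_default ?s0 // => /eqP; rewrite eq_sym oner_eq0. Qed.

Lemma lam_gt k : (k < lam k)%N.
Proof.
elim: k => [|k IH]; first by move: size0; lia.
have := sizeS k; have := N_gt0 k.+1; have := size_phi_gt0 k; nia.
Qed.

Lemma gateE k q z : abs z = 1 -> (gate k q).[z] =
  z ^+ N k * (1 - cutoff (grid k) (N k) (w k) (dead_nbhd k q) z)%:C%C.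
Proof.
move=> z1; rewrite hornerD hornerN hornerXn (cutoff_polyE _ (pw k)) //.
by rewrite rmorphB rmorph1 /= mulrBr mulr1.
Qed.

Lemma size_gate k q : (size (gate k q) <= (N k).*2.+1)%N.
Proof.
apply: leq_trans (size_polyD _ _) _; rewrite geq_max size_polyXn size_polyN.
by rewrite size_cutoff_poly andbT ltnS -addnn leq_addr.
Qed.

Lemma K_ge0 k : 0 <= K k.
Proof. exact: le_trans (abs_ge0 _) (phiK k (abs1 R)). Qed.

Lemma B_ge0 k : 0 <= B k.
Proof.
elim: k => [|k IH]; first exact: le_trans ler01 B0.
exact: le_trans (mulr_ge0 IH (K_ge0 k)) (BS k).
Qed.

Lemma gated_le k z : abs z = 1 -> abs (gated k).[z] <= abs (prod_poly k).[z].
Proof.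
move=> z1; rewrite hornerM absM gateE // absM abs_X1 // mul1r absR.
rewrite ger0_norm ?subr_ge0 ?(cutoff_le1 (pw k) (Ngrid k)) //.
by rewrite ler_piMr ?abs_ge0 // gerBl (cutoff_ge0 _ (pw k)).
Qed.

Lemma prod_poly_le k z : abs z = 1 -> abs (prod_poly k).[z] <= B k.
Proof.
move=> z1; elim: k => [|k IH]; first by rewrite hornerE abs1.
rewrite /= hornerM absM -/(gated k) horner_comp hornerXn.
apply: le_trans (BS k); apply: ler_pM; rewrite ?abs_ge0 //.
  exact: le_trans (gated_le _ z1) IH.
by apply: phiK; rewrite abs_X1.
Qed.

Lemma size_gated k : (size (gated k) <= lam k)%N.
Proof.
have sg j : (size (prod_poly j) + (N j).*2 <= lam j)%N -> (size (gated j) <= lam j)%N.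
  move=> h; apply: leq_trans (size_polyMleq _ _) _.
  have := size_gate j (prod_poly j); lia.
apply: (sg k); elim: k => [|k IH]; first by rewrite size_poly1.
apply: leq_trans (sizeS k); rewrite leq_add2r /= size_lacunary //.
  by have := lam_gt k; lia.
exact: sg.
Qed.

Lemma size_defect k : (size (defect k) <= lam k)%N.
Proof.
have -> : defect k = gated k - prod_poly k * 'X^(N k) by rewrite /defect mulrBr.
apply: leq_trans (size_polyD _ _) _; rewrite geq_max size_gated size_polyN.
apply: leq_trans (size_polyMleq _ _) _; rewrite size_polyXn addnS /=.
case: k => [|k] /=; first by rewrite size_poly1; move: size0; lia.
have := size_lacunary (phi k) (leq_ltn_trans (leq0n _) (lam_gt k)) (size_gated k).
move=> h; apply: leq_trans (sizeS k); apply: leq_add; first exact: h.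
by rewrite -addnn leq_addr.
Qed.

(** The defect is, up to sign and a unimodular factor, the product times the cutoff. Where the
    product exceeds eps, z is farther than gap/2 from every point of [dead_nbhd], so the cutoff is
    at most [leak k]. *)
Lemma defect_le k z : abs z = 1 -> abs (defect k).[z] <= eps k.
Proof.
move=> z1; rewrite hornerM hornerD hornerN gateE // hornerXn.
have -> (x : R) : z ^+ N k * (1 - x)%:C%C - z ^+ N k = - (z ^+ N k * x%:C%C).
  by rewrite rmorphB rmorph1 /=; ring.
rewrite absM absN absM abs_X1 // mul1r absR.
have c0 := cutoff_ge0 (N k) (pw k) (dead_nbhd k (prod_poly k)) z1.
have c1 := cutoff_le1 (pw k) (Ngrid k) (dead_nbhd k (prod_poly k)) z1.
rewrite ger0_norm //.
have [h|h] := lerP (abs (prod_poly k).[z]) (eps k).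
  by apply: le_trans h; rewrite ler_piMr ?abs_ge0.
apply: le_trans (leak_eps k); apply: ler_pM; rewrite ?abs_ge0 ?prod_poly_le //.
apply: (@cutoff_tail _ _ _ _ (pw k) (dead_nbhd k (prod_poly k))) => //; first by have := gap_bd k; lra.
move=> v v1 /asboolP hv; rewrite leNgt; apply/negP => hz.
by move: h; rewrite ltNge (hv z z1 (ltW hz)).
Qed.

(** Every grid point within gap/2 of z lies in [dead_nbhd] by the triangle inequality, so what the
    gate lets through at z is a tail of the complementary cutoff. *)
Lemma gated_dead k z : abs z = 1 ->
  (forall z', abs z' = 1 -> abs (z' - z) <= gap k -> abs (prod_poly k).[z'] <= eps k) ->
  abs (gated k).[z] <= B k * leak k.
Proof.
move=> z1 hz; rewrite hornerM absM gateE // absM abs_X1 // mul1r absR.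
have c1 := cutoff_le1 (pw k) (Ngrid k) (dead_nbhd k (prod_poly k)) z1.
rewrite ger0_norm ?subr_ge0 //; apply: ler_pM; rewrite ?abs_ge0 ?subr_ge0 ?prod_poly_le //.
rewrite (cutoffC (pw k) (Ngrid k)) //.
apply: (@cutoff_tail _ _ _ _ (pw k) (predC (dead_nbhd k (prod_poly k)))) => //.
  by have := gap_bd k; lra.
move=> v v1 /= /asboolP hv; rewrite leNgt; apply/negP => zv; apply: hv => z' z'1 hz'.
apply: hz => //; have := abs_tri z' v z; rewrite [abs (v - z)]absB; lra.
Qed.

Lemma dead_gated k z : abs z = 1 -> dead k z -> 0 <= rad k.+1 ->
  abs (gated k).[z] <= B k * leak k.
Proof.
move=> z1 dk r0; apply: gated_dead => // z' z'1 hz'; apply: dk => //.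
by move: hz'; rewrite /gap; lra.
Qed.

(** The gate brings the product down to [B k * leak k] before the factor, of modulus at most [K k],
    is multiplied in; the neighbourhood loses exactly the gap. *)
Lemma deadS k z : abs z = 1 -> dead k z -> dead k.+1 z.
Proof.
move=> z1 dk z' z'1 hz'; rewrite /= hornerM absM -/(gated k) horner_comp hornerXn.
apply: le_trans (leak_epsS k); apply: ler_pM; rewrite ?abs_ge0 //; last first.
  by apply: phiK; rewrite abs_X1.
apply: gated_dead => // y y1 hy; apply: dk => //.
by have := abs_tri y z' z; move: hy; rewrite /gap; lra.
Qed.

Lemma zone_dead k z : abs z = 1 ->
  (forall z', abs z' = 1 -> abs (z' - z) <= rad k.+1 ->
     B k * abs (phi k).[z' ^+ lam k] <= eps k.+1) -> dead k.+1 z.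
Proof.
move=> z1 hz z' z'1 hz'; apply: le_trans (hz z' z'1 hz').
rewrite /= hornerM absM -/(gated k) horner_comp hornerXn ler_wpM2r ?abs_ge0 //.
exact: le_trans (gated_le _ z'1) (prod_poly_le _ z'1).
Qed.


Lemma defect_coef k j : abs (defect k)`_j <= eps k.
Proof.
have e0 : 0 <= eps k by apply: le_trans (abs_ge0 _) (defect_le k (abs1 R)).
apply: (coef_bound _ (expi_prim R (leq_ltn_trans (leq0n _) (lam_gt k)))) => //.
  exact: size_defect.
exact: defect_le.
Qed.

Lemma eps_ge0 k : 0 <= eps k.
Proof. exact: le_trans (abs_ge0 _) (defect_coef k 0). Qed.

Lemma phi_coef1 k m : abs (phi k)`_m <= 1.
Proof.
case: m => [|m]; first by rewrite phi0 abs1.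
apply: le_trans (phi_coef _ _) _ => //; apply: le_trans (etaP k) _.
by rewrite exprn_ile1 //; lra.
Qed.

(** * Coefficients of the limit series *)

Definition freq_coef k (n : int) : R[i] :=
  if (n + (freq_shift k)%:Z)%R is Posz j then (prod_poly k)`_j else 0.

Lemma freq_shiftS k : freq_shift k.+1 = (freq_shift k + N k)%N.
Proof. by rewrite /freq_shift big_ord_recr. Qed.

Lemma defectE k : defect k = gated k - prod_poly k * 'X^(N k).
Proof. exact: mulrBr. Qed.

(** Within this window phi_k(z^lam_k) acts only through its constant term 1, so passing to the next
    stage changes the coefficient by a coefficient of [defect k]. *)
Lemma freq_coefS k n : n + (freq_shift k.+1)%:Z < (lam k)%:Z ->
  abs (freq_coef k.+1 n - freq_coef k n) <= eps k.
Proof.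
rewrite /freq_coef freq_shiftS PoszD addrA.
case E : (n + (freq_shift k)%:Z) => [j|j]; last first.
  case E' : (Negz j + (N k)%:Z) => [j'|j'] lt; last by rewrite subrr abs0 eps_ge0.
  have jN : (j' < N k)%N by lia.
  rewrite subr0 /= coef_lacunary ?size_gated //; last by have := lam_gt k; lia.
  rewrite divn_small ?modn_small; [|lia|lia]; rewrite phi0 mul1r.
  have -> : (prod_poly k * gate k (prod_poly k))`_j' = (defect k)`_j'; last exact: defect_coef.
  by rewrite defectE coefB coefMXn jN subr0.
rewrite -PoszD => lt; rewrite /= coef_lacunary ?size_gated //; last by have := lam_gt k; lia.
rewrite divn_small ?modn_small; [|lia|lia]; rewrite phi0 mul1r.
have -> : (prod_poly k * gate k (prod_poly k))`_(j + N k) - (prod_poly k)`_j = (defect k)`_(j + N k); last exact: defect_coef.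
by rewrite defectE coefB coefMXn ltnNge leq_addl /= addnK.
Qed.

Lemma window_mono k i : (k <= i)%N ->
  (lam k)%:Z - (freq_shift k.+1)%:Z <= (lam i)%:Z - (freq_shift i.+1)%:Z.
Proof.
move=> /subnKC <-; elim: (i - k)%N => [|d IH]; first by rewrite addn0.
apply: le_trans IH _; rewrite addnS [freq_shift (k + d).+2]freq_shiftS.
have := sizeS (k + d); have := size_phi_gt0 (k + d).
move: (freq_shift (k + d).+1) (lam (k + d)) (lam (k + d).+1) (N (k + d).+1) (size (phi (k + d))).
by move=> a b c d' e; nia.
Qed.

(** As eps at least halves, x - 2 eps increases and x + 2 eps decreases; the supremum of the former
    lies between them. *)
Lemma eps_geometric_limit (x : nat -> R) k0 :
  (forall k, (k0 <= k)%N -> `|x k.+1 - x k| <= eps k) ->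
  exists l, forall k, (k0 <= k)%N -> `|l - x k| <= 2 * eps k.
Proof.
move=> hx; pose y k := x (k0 + k)%N - 2 * eps (k0 + k)%N.
pose u k := x (k0 + k)%N + 2 * eps (k0 + k)%N.
have yS k : y k <= y k.+1.
  have := hx (k0 + k)%N (leq_addr _ _); have := epsS (k0 + k)%N; rewrite /y addnS ler_norml; lra.
have uS k : u k.+1 <= u k.
  have := hx (k0 + k)%N (leq_addr _ _); have := epsS (k0 + k)%N; rewrite /u addnS ler_norml; lra.
have ymono i j : (i <= j)%N -> y i <= y j.
  by move/subnKC <-; elim: (j - i)%N => [|d IH]; rewrite ?addn0 // addnS (le_trans IH).
have umono i j : (i <= j)%N -> u j <= u i.
  by move/subnKC <-; elim: (j - i)%N => [|d IH]; rewrite ?addn0 // addnS (le_trans _ IH).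
have yu i j : y i <= u j.
  apply: le_trans (ymono _ _ (leq_maxl i j)) _; apply: le_trans (umono _ _ (leq_maxr i j)).
  by rewrite /y /u; have := eps_ge0 (k0 + maxn i j); lra.
have hs : has_sup (range y).
  by split; [exists (y 0); exists 0 | exists (u 0) => _ [i _ <-]].
exists (sup (range y)) => k /subnKC <-; move: (k - k0)%N => {}k.
have h1 : y k <= sup (range y) by apply: ub_le_sup; [case: hs | exists k].
have h2 : sup (range y) <= u k by apply: ge_sup; [exists (y 0); exists 0 | move=> _ [i _ <-]].
by rewrite ler_norml; move: h1 h2; rewrite /y /u; lra.
Qed.

Lemma limit_coef n : exists l : R[i], forall k,
  n + (freq_shift k.+1)%:Z < (lam k)%:Z -> abs (l - freq_coef k n) <= 4 * eps k.
Proof.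
have [k1 hk1] : exists k1, n + (freq_shift k1.+1)%:Z < (lam k1)%:Z.
  exists `|n|%N.*2; have := lam_gt `|n|%N.*2; have := freq_shiftP `|n|%N.*2.
  by move: (freq_shift _) (lam _) => a b; lia.
pose P k := n + (freq_shift k.+1)%:Z < (lam k)%:Z.
have exP : exists k, P k by exists k1.
have mP k i : (k <= i)%N -> P k -> P i.
  by move=> ki; have := window_mono ki; rewrite /P; lia.
(* Windows grow with k, so starting the limit at the first one that contains n covers every
   admissible k. *)
pose k0 := ex_minn exP.
have hk0 : P k0 by rewrite /k0; case: ex_minnP.
have k0_min k : P k -> (k0 <= k)%N by rewrite /k0; case: ex_minnP => m _ h; apply: h.
have step k : (k0 <= k)%N -> abs (freq_coef k.+1 n - freq_coef k n) <= eps k.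
  by move=> h; apply: freq_coefS; apply: mP hk0.
have ReB (x y : R[i]) : complex.Re (x - y) = complex.Re x - complex.Re y.
  by case: x y => ? ? [? ?].
have ImB (x y : R[i]) : complex.Im (x - y) = complex.Im x - complex.Im y.
  by case: x y => ? ? [? ?].
have [k h|a ha] := @eps_geometric_limit (fun k => complex.Re (freq_coef k n)) k0.
  by rewrite -ReB; apply: le_trans (abs_Re _) (step k h).
have [k h|b hb] := @eps_geometric_limit (fun k => complex.Im (freq_coef k n)) k0.
  by rewrite -ImB; apply: le_trans (abs_Im _) (step k h).
exists (a +i* b)%C => k /k0_min hk; have {}ha := ha k hk; have {}hb := hb k hk.
have le_abs (x y : R) : abs (x +i* y)%C <= `|x| + `|y|.
  have -> : (x +i* y)%C = x%:C%C + 'i%C * y%:C%C.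
    by apply/eqP; rewrite eq_complex /= !mul0r !mul1r subrr addr0 !add0r !eqxx.
  apply: le_trans (absD _ _) _; rewrite absM !absR.
  by rewrite (_ : abs 'i%C = 1) ?mul1r //= expr0n expr1n add0r sqrtr1.
by case: (freq_coef k n) ha hb => x y /= ha hb; apply: le_trans (le_abs (a - x) (b - y)) _; lra.
Qed.

(** * Partial sums at dead points *)

Lemma abs_partial_sum_size (p : {poly R[i]}) J z (b : R) : abs z = 1 -> 0 <= b ->
  (forall j, abs p`_j <= b) -> abs (partial_sum p J z) <= (size p)%:R * b.
Proof.
move=> z1 b0 hb; have [Js|sJ] := leqP J (size p).
  apply: le_trans (abs_partial_sum z1 (fun j _ => hb j)) _.
  by rewrite ler_wpM2r // ler_nat.
have -> : partial_sum p J z = partial_sum p (size p) z.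
  by rewrite /partial_sum -(horner_coef_wide z (ltnW sJ)) -horner_coef.
exact: abs_partial_sum.
Qed.

Lemma partial_sumMXn (p : {poly R[i]}) m J z : partial_sum (p * 'X^m) J z = z ^+ m * partial_sum p (J - m) z.
Proof.
have [Jm|mJ] := leqP J m.
  rewrite (eqP Jm) /partial_sum big_ord0 mulr0 big1 // => j _.
  by rewrite coefMXn (leq_trans (ltn_ord j) Jm) mul0r.
rewrite -{1}(subnKC (ltnW mJ)) /partial_sum big_split_ord /= [X in X + _]big1 ?add0r.
  rewrite mulr_sumr; apply: eq_bigr => j _.
  by rewrite coefMXn ltnNge leq_addr /= addKn exprD; ring.
by move=> j _; rewrite coefMXn ltn_ord mul0r.
Qed.

(** The gated product is the ungated one shifted by N_k plus the defect, whose at most lam_k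
    coefficients are bounded by eps_k. *)
Lemma partial_sum_gated k J z : abs z = 1 ->
  abs (partial_sum (gated k) J z) <= abs (partial_sum (prod_poly k) (J - N k) z) + 2^-1 ^+ k.
Proof.
move=> z1; have E : partial_sum (gated k) J z = partial_sum (prod_poly k * 'X^(N k)) J z + partial_sum (defect k) J z.
  rewrite /partial_sum -big_split /=; apply: eq_bigr => j _.
  by rewrite defectE coefB; ring.
rewrite E partial_sumMXn; apply: le_trans (absD _ _) _; apply: lerD.
  by rewrite absM abs_X1 // mul1r.
apply: le_trans (lam_eps k).
apply: le_trans (abs_partial_sum_size _ z1 (eps_ge0 k) (defect_coef k)) _.
by rewrite ler_wpM2r ?eps_ge0 // ler_nat size_defect.
Qed.

(** At a dead point the complete blocks carry the value of [gated k], tiny enough to beat the number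
    of coefficients of phi_k; only the interrupted block remains. *)
Lemma partial_sum_prod_poly k J z : abs z = 1 -> dead k z -> 0 <= rad k.+1 ->
  abs (partial_sum (prod_poly k.+1) J z) <=
    2^-1 ^+ k + abs (phi k)`_(J %/ lam k) * abs (partial_sum (gated k) (J %% lam k) z).
Proof.
move=> z1 dk r0; rewrite /= partial_sum_lacunary ?size_gated //; last by have := lam_gt k; lia.
apply: le_trans (absD _ _) _; apply: lerD.
  rewrite absM; apply: le_trans (leak_size k); apply: ler_pM; rewrite ?abs_ge0 //.
    rewrite -[leRHS]mulr1; apply: abs_partial_sum_size => //; first by rewrite abs_X1.
    exact: phi_coef1.
  exact: dead_gated.
by rewrite !absM abs_X1 // mulr1.
Qed.

Hypothesis rad_ge0 : forall k, 0 <= rad k.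

Lemma dead_mono k i z : abs z = 1 -> dead k z -> (k <= i)%N -> dead i z.
Proof.
move=> z1 dk /subnKC <-; elim: (i - k)%N => [|d IH]; first by rewrite addn0.
by rewrite addnS; apply: deadS.
Qed.

(** Step d adds at most 3/2 times 2^-d to the bound, less than the increment 2 times 2^-d of the
    sequence M0 + 4 - 4 * 2^-d. *)
Lemma partial_sum_gated_bounded k1 z : abs z = 1 -> dead k1 z ->
  exists M : R, 0 <= M /\ forall k J, (k1 <= k)%N -> abs (partial_sum (gated k) J z) <= M.
Proof.
move=> z1 dk1.
have h1 j : abs (gated k1)`_j <= B k1.
  apply: (coef_bound _ (expi_prim R (leq_ltn_trans (leq0n _) (lam_gt k1)))).
  - exact: size_gated.
  - by move=> y y1; apply: le_trans (gated_le _ y1) (prod_poly_le _ y1).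
  - exact: B_ge0.
pose M0 := (size (gated k1))%:R * B k1.
have M00 : 0 <= M0 by rewrite mulr_ge0 ?B_ge0.
have half0 k : 0 <= 2^-1 ^+ k :> R by rewrite exprn_ge0 // invr_ge0.
exists (M0 + 4); split; first by lra.
have main d J : abs (partial_sum (gated (k1 + d)) J z) <= M0 + 4 - 4 * 2^-1 ^+ d.
  elim: d J => [|d IH] J.
    rewrite addn0 expr0; apply: le_trans (abs_partial_sum_size _ z1 (B_ge0 k1) h1) _.
    by rewrite -/M0; lra.
  have dk : dead (k1 + d) z by apply: dead_mono dk1 (leq_addr _ _).
  rewrite addnS; apply: le_trans (partial_sum_gated _ _ z1) _.
  have h := partial_sum_prod_poly (J - N (k1 + d).+1) z1 dk (rad_ge0 _).
  have p1 := phi_coef1 (k1 + d) ((J - N (k1 + d).+1) %/ lam (k1 + d)).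
  have h2 : 2^-1 ^+ (k1 + d) <= 2^-1 ^+ d :> R.
    by rewrite exprD ler_piMl // exprn_ile1 //; lra.
  have h3 : 2^-1 ^+ (k1 + d).+1 <= 2^-1 * 2^-1 ^+ d :> R.
    by rewrite exprS ler_wpM2l //; lra.
  have h4 : abs (phi (k1 + d))`_((J - N (k1 + d).+1) %/ lam (k1 + d)) *
     abs (partial_sum (gated (k1 + d)) ((J - N (k1 + d).+1) %% lam (k1 + d)) z) <= M0 + 4 - 4 * 2^-1 ^+ d.
    apply: le_trans (IH ((J - N (k1 + d).+1) %% lam (k1 + d))%N).
    by rewrite ler_piMl ?abs_ge0.
  rewrite [2^-1 ^+ d.+1]exprS; have := half0 d; lra.
move=> k J /subnKC <-; apply: le_trans (main _ _) _.
by have := half0 (k - k1)%N; lra.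
Qed.

Lemma sum_freq_coef k n z : (freq_shift k <= n)%N -> abs z = 1 ->
  abs (\sum_(j < n.*2.+1) freq_coef k (j%:Z - n%:Z) * z ^+ j) =
  abs (partial_sum (prod_poly k) (n + freq_shift k).+1 z).
Proof.
move=> sn z1; have E : n.*2.+1 = ((n - freq_shift k) + (n + freq_shift k).+1)%N by lia.
rewrite E big_split_ord /= big1 ?add0r.
  have -> : \sum_(i < (n + freq_shift k).+1) freq_coef k ((n - freq_shift k + i)%:Z - n%:Z) * z ^+ (n - freq_shift k + i)
    = z ^+ (n - freq_shift k) * partial_sum (prod_poly k) (n + freq_shift k).+1 z.
    rewrite /partial_sum mulr_sumr; apply: eq_bigr => i _.
    rewrite /freq_coef (_ : _ - _ + _ = Posz i); last by lia.
    by rewrite exprD; ring.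
  by rewrite absM abs_X1 // mul1r.
move=> j _; rewrite /freq_coef.
case e : (_ + _) => [m|m]; last by rewrite mul0r.
by have := ltn_ord j; lia.
Qed.

Theorem lacunary_null_series : exists c : int -> R[i],
  [/\ c 0 != 0,
      forall n k, (freq_shift k < n <= freq_shift k.+1)%N -> abs (c (- n%:Z)) <= 4 * eps k
    & forall z, abs z = 1 -> (exists k, dead k z) ->
      forall e, 0 < e -> exists n0, forall n, (n0 <= n)%N ->
        abs (\sum_(j < n.*2.+1) c (j%:Z - n%:Z) * z ^+ j) <= e].
Proof.
have [c hc] := choice limit_coef; exists c; split.
(* The constant coefficient at stage 0 is 1, and the limit differs from it by at most 4 eps_0 <=
   1/2. *)
- have h0 : (0 : int) + (freq_shift 1)%:Z < (lam 0)%:Z by have := freq_shiftP 0; lia.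
  have := hc 0 0 h0; rewrite /freq_coef /freq_shift big_ord0 /= coef1 => h.
  apply/eqP => c0; move: h; rewrite c0 sub0r absN abs1; have := eps0; lra.
(* The frequency -n is below all those of stage k, so its coefficient there is 0 and c(-n) only
   collects later defects. *)
- move=> n k /andP[kn nk].
  have h0 : - n%:Z + (freq_shift k.+1)%:Z < (lam k)%:Z by have := freq_shiftP k; lia.
  have := hc _ _ h0; rewrite /freq_coef.
  by case e : (- n%:Z + (freq_shift k)%:Z) => [j|j]; rewrite ?subr0 //; lia.
move=> z z1 [k1 dk1] e e0.
have [M [M0 hM]] := partial_sum_gated_bounded z1 dk1.
have half0 k : 0 <= 2^-1 ^+ k :> R by rewrite exprn_ge0 // invr_ge0.
(* The constant is 1 + 24 + M: complete blocks, replacement of c by the coefficients of a single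
   stage, interrupted block. *)
have [k2 hk2] : exists k2, forall k, (k2 <= k)%N -> 2^-1 ^+ k * (25 + M) <= e.
  have p : 0 < (25 + M) / e by rewrite divr_gt0 //; lra.
  exists (Num.Def.truncn ((25 + M) / e)).+1 => k hk.
  have h : (25 + M) / e <= k%:R.
    apply: le_trans (ltW (truncnS_gt _)) _; by rewrite ler_nat.
  have h2 := natr_le_exp2 R k.
  rewrite exprVn mulrC ler_pdivrMr ?exprn_gt0 // -ler_pdivrMl // mulrC.
  exact: le_trans h h2.
exists (lam (maxn k1 k2)) => n hn.
pose P k := (n + freq_shift k.+1 < lam k)%N.
have exP : exists k, P k.
  by exists n.*2; rewrite /P; have := lam_gt n.*2; have := freq_shiftP n.*2; lia.
(* Take the first stage whose window contains n. By minimality the cut falls past the block of index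
   0 of the preceding stage, so the interrupted block carries a coefficient of phi of positive
   index, which is at most eta. *)
case: (ex_minnP exP) => k Pk kmin.
have kbig : (maxn k1 k2 < k)%N.
  rewrite ltnNge; apply/negP => hk; have := window_mono hk; move: Pk; rewrite /P; lia.
case: k Pk kmin kbig => // k Pk kmin kbig.
have nPk : ~~ P k by apply/negP => /kmin; rewrite ltnn.
have /andP[k1k k2k] : (k1 <= k)%N && (k2 <= k)%N by rewrite -geq_max.
have dk : dead k z by apply: dead_mono dk1 _.
have sn : (freq_shift k.+1 <= n)%N by move: nPk; rewrite /P; have := freq_shiftP k; lia.
have h1 : abs (\sum_(j < n.*2.+1) c (j%:Z - n%:Z) * z ^+ j
        - \sum_(j < n.*2.+1) freq_coef k.+1 (j%:Z - n%:Z) * z ^+ j) <= 24 * 2^-1 ^+ k.+1.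
  rewrite -sumrB; apply: le_trans (abs_sum _ _ _) _.
  apply: le_trans (_ : \sum_(j < n.*2.+1) 4 * eps k.+1 <= _).
    apply: ler_sum => j _; rewrite -mulrBl absM abs_X1 // mulr1.
    by apply: hc; have := ltn_ord j; move: Pk; rewrite /P; lia.
  rewrite sumr_const card_ord -[leLHS]mulr_natr.
  have : (n.*2.+1)%:R <= 6 * (lam k.+1)%:R :> R.
    by rewrite -natrM ler_nat; move: Pk; rewrite /P; lia.
  move=> h; have := lam_eps k.+1; have := eps_ge0 k.+1; nra.
have h2 := sum_freq_coef sn z1.
have h3 := partial_sum_prod_poly (n + freq_shift k.+1).+1 z1 dk (rad_ge0 _).
have m1 : (0 < (n + freq_shift k.+1).+1 %/ lam k)%N.
  by rewrite divn_gt0; [move: nPk; rewrite /P; lia | have := lam_gt k; lia].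
have h4 := phi_coef k m1; have h5 := etaP k.
have h6 := hM k ((n + freq_shift k.+1).+1 %% lam k)%N k1k.
have h7 := hk2 k k2k.
have h8 : abs (phi k)`_((n + freq_shift k.+1).+1 %/ lam k)
   * abs (partial_sum (gated k) ((n + freq_shift k.+1).+1 %% lam k) z) <= 2^-1 ^+ k * M.
  by apply: ler_pM; rewrite ?abs_ge0 // (le_trans h4).
have h9 := absBle (\sum_(j < n.*2.+1) c (j%:Z - n%:Z) * z ^+ j)
   (\sum_(j < n.*2.+1) freq_coef k.+1 (j%:Z - n%:Z) * z ^+ j).
have h10 : 2^-1 ^+ k.+1 <= 2^-1 ^+ k :> R by rewrite exprS ler_piMl //; lra.
rewrite h2 in h9; lra.
Qed.

End Assembly.

(** * Nested covers *)

Section NullCover.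
Variable R : realType.
Local Notation mu := (@lebesgue_measure R).

Lemma nat_cell (b : nat) (y : R) : (0 < b)%N -> 0 <= y <= b%:R ->
  exists2 i, (i < b)%N & i%:R <= y <= i.+1%:R.
Proof.
case: b => // b _; elim: b => [|b IH] /andP[y0 yb]; first by exists 0%N; rewrite ?y0.
have [h|h] := lerP y b.+1%:R; last by exists b.+1; rewrite // (ltW h) yb.
by have [|i ib hi] := IH; [rewrite y0 h | exists i => //; lia].
Qed.

(** The induction rests on (1 - x)(1 + S + x) <= 1 + S. In this form a divergent sum of densities
    forces the product to 0. *)
Lemma prod_le_inv_sum (d : nat -> R) n : (forall k, 0 <= d k <= 1) ->
  (\prod_(k < n) (1 - d k)) * (1 + \sum_(k < n) d k) <= 1.
Proof.
move=> hd; elim: n => [|n IH]; first by rewrite !big_ord0 addr0 mulr1.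
rewrite !big_ord_recr /=; have := hd n.
have : 0 <= \prod_(k < n) (1 - d k).
  by apply: prodr_ge0 => k _; have := hd k; lra.
have : 0 <= \sum_(k < n) d k by apply: sumr_ge0 => k _; have := hd k; lra.
move: IH; set P := \prod_(_ < _) _; set S := \sum_(_ < _) _; set x := d n.
move=> IH S0 P0 x01; have : 0 <= P * (x * S + x ^+ 2).
  by rewrite mulr_ge0 // addr_ge0 ?mulr_ge0 ?sqr_ge0 //; lra.
nra.
Qed.

Variables (lam b : nat -> nat) (Bad : nat -> seq nat) (d : nat -> R).
Hypothesis lam_gt0 : forall k, (0 < lam k)%N.
Hypothesis lamS : forall k, lam k.+1 = (lam k * b k)%N.
Hypothesis d01 : forall k, 0 <= d k <= 1.
Hypothesis BadP : forall k, (size (Bad k))%:R <= (b k)%:R * (1 - d k).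
Hypothesis sum_d : forall A : R, exists n, A <= \sum_(k < n) d k.
Variable good : nat -> R -> Prop.

Let ell k : R := 2 * pi / (lam k)%:R.
Definition cell k (i : nat) : set R := `[i%:R * ell k, i.+1%:R * ell k]%classic.

Hypothesis goodP : forall k i i' t, (i' < b k)%N -> i' \notin Bad k ->
  cell k.+1 (i * b k + i') t -> good k t.

(** The cells of level k not yet known to be good: each survivor is split into [b k] subcells, of
    which those indexed by [Bad k] are kept. *)
Fixpoint bad_cells k : seq nat :=
  if k is k'.+1 then [seq (i * b k' + i')%N | i <- bad_cells k', i' <- Bad k']
  else iota 0 (lam 0).

Let lam0R k : 0 < (lam k)%:R :> R. Proof. by rewrite ltr0n. Qed.
Let ell0 k : 0 < ell k. Proof. by rewrite divr_gt0 // mulr_gt0 // pi_gt0. Qed.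
Let b0 k : (0 < b k)%N.
Proof. by have := lam_gt0 k.+1; rewrite lamS muln_gt0 => /andP[]. Qed.

Lemma size_bad_cells k :
  (size (bad_cells k))%:R <= (lam k)%:R * \prod_(j < k) (1 - d j).
Proof.
elim: k => [|k IH]; first by rewrite big_ord0 mulr1 size_iota.
rewrite /= size_allpairs natrM big_ord_recr /= lamS natrM.
rewrite mulrACA; apply: ler_pM => //; exact: BadP.
Qed.

Lemma bad_cover k t : 0 <= t <= 2 * pi -> (forall j, ~ good j t) ->
  exists2 i, i \in bad_cells k & cell k i t.
Proof.
move=> ht ng; elim: k => [|k [i ib hi]].
  have [||i il hi] := @nat_cell (lam 0) (t / ell 0) => //.
    rewrite divr_ge0 ?(ltW (ell0 0)) //=; last by case/andP: ht.
    rewrite ler_pdivrMr // /ell mulrCA divff ?gt_eqF // mulr1.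
    by case/andP: ht.
  exists i; first by rewrite mem_iota.
  by move: hi; rewrite /cell /= in_itv /= ler_pdivlMr // ler_pdivrMr.
have eS : ell k = (b k)%:R * ell k.+1.
  by rewrite /ell lamS natrM; field; rewrite !gt_eqF ?ltr0n.
move: hi; rewrite /cell /= in_itv /= => /andP[h1 h2].
have [||i' il hi'] := @nat_cell (b k) (t / ell k.+1 - (i * b k)%:R) => //.
  rewrite subr_ge0 ler_pdivlMr // natrM -mulrA -eS h1 /=.
  rewrite lerBlDr ler_pdivrMr // mulrDl -mulrA -eS.
  by move: h2; rewrite -natr1 mulrDl mul1r addrC.
have hc : cell k.+1 (i * b k + i') t.
  rewrite /cell /= in_itv /=.
  by move: hi'; rewrite lerBrDl lerBlDl -!natrD addnS ler_pdivlMr // ler_pdivrMr.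
exists (i * b k + i')%N => //; apply/allpairsP; exists (i, i') => /=; split=> //.
by apply: contraT => nb; have := goodP il nb hc; move/ng.
Qed.

Lemma cells_measure k (s : seq nat) : exists U : set R,
  [/\ measurable U, forall i, i \in s -> (cell k i `<=` U)%classic
    & (mu U <= ((size s)%:R * ell k)%:E)%E].
Proof.
elim: s => [|i s [U [mU hU lU]]].
  by exists set0; split=> //; rewrite measure0 mul0r.
exists (cell k i `|` U)%classic; split.
- by apply: measurableU => //; exact: measurable_itv.
- move=> j; rewrite inE => /predU1P[->|js]; first by left.
  by move=> x hx; right; apply: hU js _ hx.
apply: le_trans (_ : (mu (cell k i) + mu U <= _)%E).
  by apply: measureU2 => //; exact: measurable_itv.
rewrite /= -natr1 mulrDl mul1r addrC EFinD; apply: leeD => //.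
rewrite /cell lebesgue_measure_itv /= lte_fin ltr_pM2r // ltr_nat ltnSn.
by rewrite -EFinB lee_fin -mulrBl -natr1 addrAC subrr add0r mul1r.
Qed.

(** The exceptional set lies in the union of the surviving cells of every level, whose measure is at
    most 2 pi times the product of the 1 - d_j. *)
Lemma ae_good : {ae mu, forall t : R, t \in `[0, 2 * pi]%R -> exists k, good k t}.
Proof.
have [U hU] := choice (fun k => cells_measure k (bad_cells k)).
exists (\bigcap_k U k)%classic; split.
- by apply: bigcap_measurable => // k _; case: (hU k).
- apply/eqP; rewrite -measure_le0; apply/lee_addgt0Pr => e e0; rewrite add0e.
  have [n hn] := sum_d (2 * pi / e).
  have [mU _ lU] := hU n.
  apply: le_trans (_ : (mu (U n) <= _)%E).
    apply: le_measure; rewrite ?inE //; last by apply: bigcap_inf.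
    by apply: bigcap_measurable => // k _; case: (hU k).
  apply: le_trans lU _; rewrite lee_fin.
  apply: le_trans (ler_wpM2r (ltW (ell0 n)) (size_bad_cells n)) _.
  have h := prod_le_inv_sum n d01.
  have -> : (lam n)%:R * \prod_(j < n) (1 - d j) * ell n = 2 * pi * \prod_(j < n) (1 - d j).
    by rewrite /ell; field; rewrite gt_eqF.
  have P0 : 0 <= \prod_(k < n) (1 - d k).
    by apply: prodr_ge0 => k _; have := d01 k; lra.
  move: h hn P0; set P := \prod_(_ < _) _; set S := \sum_(_ < _) _.
  rewrite ler_pdivrMr // => h hn P0; have := @pi_gt0 R; nra.
move=> t /= ht k _; case: (hU k) => _ hk _.
have [||i ib hi] := @bad_cover k t; last exact: hk hi.
- apply: contrapT => h; apply: ht => h2; exfalso; apply: h.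
  by move: h2; rewrite in_itv.
- by move=> j gj; apply: ht => _; exists j.
Qed.

End NullCover.

(** * Concave weights *)

Section Weight.
Variable R : realType.
Variable h : R -> R.
Hypothesis h_pos : forall t, 0 < t -> 0 < h t.
Hypothesis h_concave : concave_on_pos h.

(** If h decreased from x to y, the chord through these points would vanish at some z > y, and
    concavity would force h(z) <= 0. *)
Lemma concave_pos_ndecr x y : 0 < x -> x <= y -> h x <= h y.
Proof.
move=> x0; rewrite le_eqVlt => /predU1P[-> //|xy]; rewrite leNgt; apply/negP => hlt.
have y0 : 0 < y by exact: lt_trans xy.
have hy := h_pos y0; have hx := h_pos x0.
have D : 0 < h x - h y by rewrite subr_gt0.
pose z := y + (y - x) * h y / (h x - h y).
have zy : 0 < z - y by rewrite /z addrAC subrr add0r !mulr_gt0 ?subr_gt0 ?invr_gt0.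
have zx : 0 < z - x by lra.
have z0 : 0 < z by lra.
pose l := (z - y) / (z - x).
have l0 : 0 <= l by rewrite divr_ge0 // ltW.
have l1 : l <= 1 by rewrite ler_pdivrMr // mul1r; lra.
have := h_concave x0 z0 l0 l1.
have -> : l * x + (1 - l) * z = y by rewrite /l; field; rewrite gt_eqF.
have l1' : l < 1 by rewrite ltr_pdivrMr // mul1r; lra.
have -> : l * h x = h y.
  rewrite /l /z; field; rewrite (gt_eqF D) /=.
  have -> : y * (h x - h y) + (y - x) * h y + - x * (h x - h y) = (y - x) * h x by ring.
  by rewrite mulf_neq0 // gt_eqF // subr_gt0.
have := h_pos z0; nra.
Qed.

(** Concavity on 1/2 < 1 <= t, where the positive term in h(1/2) is dropped. *)
Lemma concave_pos_linear t : 1 <= t -> h t <= 2 * h 1 * t.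
Proof.
move=> t1; have t0 : 0 < t by exact: lt_le_trans t1.
have D : 0 < t - 2^-1 by lra.
pose l := (t - 1) / (t - 2^-1).
have l0 : 0 <= l by rewrite divr_ge0 //; lra.
have l1 : l <= 1 by rewrite ler_pdivrMr // mul1r; lra.
have i0 : 0 < 2^-1 :> R by rewrite invr_gt0.
have := h_concave i0 t0 l0 l1.
have -> : l * 2^-1 + (1 - l) * t = 1 by rewrite /l; field; rewrite gt_eqF //; lra.
have -> : 1 - l = 2^-1 / (t - 2^-1) by rewrite /l; field; rewrite gt_eqF //; lra.
have hp := h_pos i0; have h1 := h_pos ltr01.
move=> hc; have {}hc : 2^-1 / (t - 2^-1) * h t <= h 1 by have := mulr_ge0 l0 (ltW hp); lra.
have {}hc : 2^-1 * h t <= h 1 * (t - 2^-1) by rewrite -ler_pdivrMr // mulrAC.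
have := h_pos t0; lra.
Qed.

(** Cauchy condensation: as h is nondecreasing, each of the at most 256 a_k terms between a_k and
    a_(k+1) is at most 1/(a_k h(a_k)). *)
Lemma condensation (a : nat -> nat) :
  (forall k, (0 < a k)%N) -> (forall k, (a k < a k.+1 <= 257 * a k)%N) ->
  ((fun N : nat => \sum_(0 <= k < N) (k.+1%:R * h k.+1%:R)^-1) @ \oo --> +oo)%classic ->
  forall A : R, exists n, A <= \sum_(k < n) (h (a k)%:R)^-1.
Proof.
move=> a0 aS div A.
pose F n := (n.+1%:R * h n.+1%:R)^-1 : R.
have F0 n : 0 <= F n by rewrite invr_ge0 mulr_ge0 // ltW // h_pos.
have key K : \sum_(0 <= n < a K) F n <= \sum_(0 <= n < a 0%N) F n
    + 256 * \sum_(k < K) (h (a k)%:R)^-1.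
  elim: K => [|K IH]; first by rewrite big_ord0 mulr0 addr0.
  have /andP[aK aK'] := aS K.
  rewrite (big_cat_nat (leq0n (a K)) (ltnW aK)) //= big_ord_recr /= mulrDr addrA; apply: lerD => //.
  have aK0 : 0 < (a K)%:R :> R by rewrite ltr0n.
  have hK := h_pos aK0.
  apply: le_trans (_ : \sum_(a K <= n < a K.+1) ((a K)%:R * h (a K)%:R)^-1 <= _).
    apply: ler_sum_nat => n /andP[an _].
    rewrite lef_pV2 ?posrE ?mulr_gt0 ?h_pos //.
    have le : (a K)%:R <= n.+1%:R :> R by rewrite ler_nat leqW.
    by apply: ler_pM => //; [exact: ltW hK | exact: concave_pos_ndecr].
  rewrite sumr_const_nat -[leLHS]mulr_natl invfM mulrA ler_pM2r ?invr_gt0 //.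
  rewrite ler_pdivrMr // -natrM ler_nat; lia.
have /cvgryPge /(_ (\sum_(0 <= n < a 0%N) F n + 256 * A)) [N _ hN] := div.
have amono K : (K <= a K)%N.
  by elim: K => // K IH; have /andP[aK _] := aS K; apply: leq_ltn_trans aK.
exists N; have := hN (a N) (amono N); have := key N; rewrite -/F; lra.
Qed.

End Weight.

(** * Counting good grid indices *)

(** The indices built from I, j, e are distinct: I is the quotient by nu q; once (I^2 mod M) q is
    added back, j + 1 is the quotient by M q and e the remainder. In [stage_count] the shift by I^2
    mod M cancels the phase zeta^(I^2). *)
Lemma count_grid (P : pred nat) (M nu q J E : nat) :
  (0 < q)%N -> (0 < M)%N -> (J.+1 * M <= nu)%N -> (E <= M * q)%N ->
  (forall I j e, (I < M)%N -> (j < J)%N -> (e < E)%N ->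
     P (I * (nu * q) + (j.+1 * M - I ^ 2 %% M) * q + e)%N) ->
  (M * J * E <= count P (iota 0 (M * (nu * q))))%N.
Proof.
move=> q0 M0 JM EM hP.
pose g (x : nat * nat) e := (x.1 * (nu * q) + (x.2.+1 * M - x.1 ^ 2 %% M) * q + e)%N.
pose X := [seq (i, j) | i <- iota 0 M, j <- iota 0 J].
have XP x : x \in X -> (x.1 < M)%N /\ (x.2 < J)%N.
  by case/allpairsP => -[I j] /= [] ; rewrite !mem_iota /= !add0n => IM jJ ->.
have rest x e : x \in X -> (e < E)%N ->
    ((x.2.+1 * M - x.1 ^ 2 %% M) * q + e < nu * q)%N.
  case/XP => _ xJ eE; have rM : (x.1 ^ 2 %% M < M)%N by rewrite ltn_mod.
  apply: leq_trans (_ : x.2.+2 * M * q <= _)%N.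
    apply: leq_ltn_trans (_ : x.2.+1 * M * q + e < _)%N; first by rewrite leq_add2r leq_mul2r leq_subr orbT.
    by rewrite [(x.2.+2 * M)%N]mulSnr mulnDl ltn_add2l (leq_trans eE).
  by rewrite leq_mul2r (leq_trans _ JM) ?orbT // leq_mul2r ltnS xJ orbT.
have u1 : uniq [seq g x e | x <- X, e <- iota 0 E].
  apply: allpairs_uniq; rewrite ?iota_uniq //.
    apply: allpairs_uniq; rewrite ?iota_uniq //.
    by move=> [I j] [I' j'] _ _ /= [-> ->].
  move=> [x e] [x' e'] /allpairsP[[y1 y2] /= [hx he [-> ->]]] /allpairsP[[z1 z2] /= [hx' he' [-> ->]]].
  rewrite {}/g /= => eq.
  move: he he'; rewrite !mem_iota /= !add0n => he he'.
  have r := rest _ _ hx he; have r' := rest _ _ hx' he'.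
  have nq0 : (0 < nu * q)%N by apply: leq_ltn_trans r.
  have e1 : y1.1 = z1.1.
    have := congr1 (divn^~ (nu * q)%N) eq.
    by rewrite -!addnA !divnMDl // !divn_small // !addn0.
  have rM : (z1.1 ^ 2 %% M < M)%N by rewrite ltn_mod.
  move: eq; rewrite -!addnA e1 => /addnI eq.
  have Mq0 : (0 < M * q)%N by rewrite muln_gt0 M0.
  have E2 (j a : nat) : (j.+1 * (M * q) + a = (j.+1 * M - z1.1 ^ 2 %% M) * q + a + z1.1 ^ 2 %% M * q)%N.
    rewrite mulnBl addnAC subnK ?mulnA // leq_mul2r ltnW ?orbT //.
    by rewrite (leq_trans rM) // leq_pmull.
  have eq2 : (y1.2.+1 * (M * q) + y2 = z1.2.+1 * (M * q) + z2)%N by rewrite !E2 eq.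
  have hy : (y2 < M * q)%N := leq_trans he EM; have hz : (z2 < M * q)%N := leq_trans he' EM.
  have e2 : y1.2 = z1.2.
    have := congr1 (divn^~ (M * q)%N) eq2.
    by rewrite !divnMDl // !divn_small // !addn0 => -[].
  move: eq2; rewrite e2 => /addnI ->.
  by move: e1 e2; case: (y1) (z1) => ? ? [? ?] /= -> ->.
have sub : {subset [seq g x e | x <- X, e <- iota 0 E] <= [seq i <- iota 0 (M * (nu * q)) | P i]}.
  move=> i /allpairsP[[x e] /= [hx]]; rewrite mem_iota /= add0n => he ->.
  have [xM xJ] := XP _ hx; rewrite mem_filter mem_iota /= add0n hP //=.
  rewrite /g -addnA; apply: leq_trans (_ : x.1.+1 * (nu * q) <= _)%N.
    by rewrite [(x.1.+1 * _)%N]mulSnr ltn_add2l rest.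
  by rewrite leq_mul2r xM orbT.
have := uniq_leq_size u1 sub.
by rewrite size_filter !size_allpairs !size_iota.
Qed.

(** * Estimates with powers of two *)

Section Halves.
Variable R : realType.
Local Notation half := (2^-1 : R).

Lemma half_exp_le a b : (b <= a)%N -> half ^+ a <= half ^+ b.
Proof. by move=> ba; rewrite ler_wiXn2l //; lra. Qed.

Lemma pow2_half a b c : (a + c <= b)%N -> 2 ^+ a * half ^+ b <= half ^+ c.
Proof.
move=> h; rewrite -(subnKC h) !exprD !mulrA -exprMn divff ?pnatr_eq0 // expr1n mul1r.
by rewrite ler_piMr ?exprn_ge0 ?exprn_ile1 //; lra.
Qed.

Lemma half_expE a : half ^+ a = (2 ^+ a)^-1.
Proof. by rewrite exprVn. Qed.

Lemma expr_le_half (x : R) m a : 0 <= x -> x <= 1 - half ^+ m ->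
  x ^+ (2 ^ (m + a)) <= half ^+ (2 ^ a).
Proof.
move=> x0 xm; rewrite expnD exprM.
apply: lerXn2r; rewrite ?nnegrE ?exprn_ge0 //.
have := @expr_1subV_le R (2 ^ m) (expn_gt0 _ _); apply: le_trans.
by apply: lerXn2r; rewrite ?nnegrE ?natrX -?half_expE // (le_trans x0).
Qed.

(** The inverse of 1 + 1/(2s) is 1 - 1/(2s + 1), whose s-th power is at least 1/2 by Bernoulli's
    inequality; the exponent 4s then gives 2^4. *)
Lemma expr_1add_le (s : nat) : (0 < s)%N ->
  (1 + 2 / (4 * s)%:R) ^+ (4 * s) <= 16 :> R.
Proof.
move=> s0; have s0R : 0 < s%:R :> R by rewrite ltr0n.
pose x : R := 1 - 1 / (2 * s%:R + 1).
have dpos : 0 < 2 * s%:R + 1 :> R by lra.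
have x0 : 0 < x by rewrite /x subr_gt0 ltr_pdivrMr //; lra.
have -> : 1 + 2 / (4 * s)%:R = x^-1.
  rewrite /x natrM; field; rewrite !gt_eqF //=; lra.
have xs : 2^-1 <= x ^+ s.
  have bern n : 1 - n%:R * (1 / (2 * s%:R + 1)) <= x ^+ n.
    elim: n => [|n IH]; first by rewrite mul0r subr0.
    have t0 : 0 < 1 / (2 * s%:R + 1) :> R by rewrite divr_gt0.
    rewrite exprS -natr1 /x; move: IH t0 (ler0n R n) x0; rewrite /x.
    move: (1 / _) (n%:R : R) (_ ^+ n) => t m y IH t0 m0 x0; nra.
  apply: le_trans (bern s).
  have : s%:R * (1 / (2 * s%:R + 1)) <= 2^-1 :> R by rewrite mulrA mulr1 ler_pdivrMr //; lra.
  lra.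
rewrite exprVn mulnC exprM -[leRHS]invrK lef_pV2 ?posrE ?exprn_gt0 ?invr_gt0 //.
have -> : 16^-1 = 2^-1 ^+ 4 :> R by field.
by apply: lerXn2r; rewrite ?nnegrE ?exprn_ge0 // ltW.
Qed.

End Halves.

(** * Parameters of one stage *)

Section Stage.
Variable R : realType.
Local Notation abs := (@Normc.normc R).
Local Notation half := (2^-1 : R).
Implicit Types (z y : R[i]).
Variables (f s H : nat).
Hypotheses (f16 : (16 <= f)%N) (sP : exists sg, s = (2 ^ sg)%N).
Hypothesis sH : (1024 * (H + 5) <= s)%N.
Hypothesis sf : (s * (4 * f) <= 2 ^ f)%N.

Let u := (4 * f)%N.
(** Here 2^u is the frequency of the stage. M = 2^(12u) makes the bound K^2 * 2d/M of the squared
    coefficients at most 2^(-2u); N = 2^8 M^3 makes cutoff tails at distance 1/(8M) doubly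
    exponentially small in u; nu = 4N keeps the blocks apart. *)
Definition stage_M := (2 ^ (12 * u))%N.
Definition stage_N := (2 ^ (36 * u + 8))%N.
Definition stage_nu := (2 ^ (36 * u + 10))%N.
Definition stage_deg := (s * s * (s * u))%N.
Definition stage_root : R[i] := expi (2 * pi / stage_nu%:R).
(** The power s u raises the maximum 1 + 2/s to at most 2^(4u), while it deepens the dip to
    (3/4)^(su). *)
Definition stage_dip : {poly R[i]} := dip_poly R s ^+ (s * u).
Definition stage_poly : {poly R[i]} := factor stage_M stage_N stage_nu stage_nu stage_deg stage_root stage_dip.
Definition stage_bound : R := 2 ^+ (4 * u).

Let s4 : (4 <= s)%N. Proof. by move: sH; nia. Qed.
Let M0 : (0 < stage_M)%N. Proof. by rewrite expn_gt0. Qed.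
Let nu0 : (0 < stage_nu)%N. Proof. by rewrite expn_gt0. Qed.
Let pw : stage_nu.-primitive_root stage_root. Proof. exact: expi_prim. Qed.
Let Mnu : (stage_M %| stage_nu)%N. Proof. by apply: dvdn_exp2l; rewrite /u; lia. Qed.
Let Nnu : (stage_N.*2.+1 <= stage_nu)%N.
Proof. by rewrite -mul2n -expnS ltn_exp2l //; lia. Qed.

Let d_le : (stage_deg <= 2 ^ (3 * f))%N.
Proof.
apply: leq_trans (_ : (s * u) ^ 3 <= _)%N.
  have -> : stage_deg = (s ^ 3 * u)%N by rewrite /stage_deg !expnS expn0; lia.
  rewrite expnMn leq_mul2l -{1}(expn1 u) leq_pexp2l ?orbT //.
  by rewrite muln_gt0; case: f f16.
by rewrite [(3 * f)%N]mulnC expnM leq_exp2r.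
Qed.

Let dnu : (stage_deg < stage_nu)%N.
Proof. by apply: leq_ltn_trans d_le _; rewrite ltn_exp2l // /u; lia. Qed.

Let Q0 : stage_dip`_0 = 1.
Proof. by rewrite -horner_coef0 horner_exp horner_coef0 dip_poly0 expr1n. Qed.

Let sQ : (size stage_dip <= stage_deg.+1)%N.
Proof.
apply: leq_trans (size_poly_exp_leq _ _) _; rewrite ltnS leq_mul2r; apply/orP; right.
by rewrite -subn1 leq_subLR add1n size_dip_poly.
Qed.

Let QK z : abs z = 1 -> abs stage_dip.[z] <= stage_bound.
Proof.
move=> z1; rewrite horner_exp absX exprM /stage_bound exprM.
have [sg hs] := sP.
have e16 : (2 : R) ^+ 4 = 16 by rewrite -natrX.
rewrite e16; apply: lerXn2r; rewrite ?nnegrE ?exprn_ge0 ?abs_ge0 //.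
have hdip := dip_bound s4 z1.
apply: le_trans (lerXn2r s _ _ hdip) _; rewrite ?nnegrE ?abs_ge0 //.
have [m hm] : exists m, s = (4 * m)%N.
  case: sg hs => [|[|sg]] hs; [by move: s4; rewrite hs | by move: s4; rewrite hs |].
  by exists (2 ^ sg)%N; rewrite hs !expnS mulnA.
by rewrite hm; apply: expr_1add_le; move: s4; rewrite hm; lia.
Qed.

Let K1 : 1 <= stage_bound. Proof. by rewrite exprn_ege1 // ler1n. Qed.

Lemma stage_coef0 : stage_poly`_0 = 1.
Proof. exact: (factor0 _ _ _ _ _ Nnu). Qed.

Lemma stage_le z : abs z = 1 -> abs stage_poly.[z] <= stage_bound.
Proof. by move=> z1; exact: (factor_le M0 pw Mnu Nnu Nnu Q0 sQ QK K1 z1). Qed.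

Lemma stage_size : (size stage_poly <= 2 ^ (40 * u))%N.
Proof.
apply: leq_trans (size_factor _ _ _ _ _ Nnu) _.
apply: leq_trans (_ : stage_nu * 2 ^ (3 * f + 1) <= _)%N.
  rewrite leq_mul2l; apply/orP; right; rewrite expnD expn1 muln2 -addnn.
  by have := d_le; have : (0 < 2 ^ (3 * f))%N by [rewrite expn_gt0]; lia.
by rewrite -expnD leq_exp2l // /u; lia.
Qed.

Lemma stage_coef m : (0 < m)%N -> abs stage_poly`_m <= half ^+ u.
Proof.
move=> m0; rewrite -(@ler_pXn2r _ 2) ?nnegrE ?abs_ge0 ?exprn_ge0 //.
have h := factor_coef M0 pw Mnu Nnu Nnu sQ QK K1 dnu m0.
apply: le_trans h _.
have MV : stage_M%:R^-1 = half ^+ (12 * u) :> R by rewrite /stage_M natrX half_expE.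
have dR : stage_deg.*2%:R <= 2 ^+ (3 * f + 1) :> R.
  by rewrite -natrX ler_nat expnD expn1 muln2 leq_double.
rewrite MV /stage_bound -!exprM.
apply: le_trans (_ : 2 ^+ (4 * u * 2) * (2 ^+ (3 * f + 1) * half ^+ (12 * u)) <= _).
  by rewrite ler_pM2l ?exprn_gt0 // ler_pM2r // exprn_gt0 // invr_gt0.
by rewrite mulrA -exprD; apply: pow2_half; rewrite /u; lia.
Qed.

Let zeta : R[i] := stage_root ^+ (stage_nu %/ stage_M).

Lemma stage_zetaE : zeta = expi (2 * pi / stage_M%:R).
Proof.
rewrite /zeta /stage_root expiX; congr expi.
rewrite natr_div ?unitfE ?pnatr_eq0 -?lt0n //.
by field; rewrite !pnatr_eq0 -!lt0n M0 nu0.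
Qed.

(** The dip and the cutoff tail are each brought below 2^-(256u(H + 3) + u + 1): the dip since
    (3/4)^4 <= 1/2 and s >= 1024(H + 5), the tail since it is doubly exponential. The final exponent
    is that of the next tolerance, whose frequency exponent is 256u. *)
Lemma stage_near y I : (I < stage_M)%N -> abs y = 1 ->
  abs (y - zeta ^+ I) <= (8 * stage_M%:R)^-1 ->
  abs (zeta ^+ (I ^ 2) * y ^+ stage_nu - 1) <= s%:R^-1 / 2 ->
  2 ^+ u * abs stage_poly.[y] <= half ^+ (256 * u * (H + 3)).
Proof.
move=> IM y1 hy1 hy2.
have h := factor_near M0 pw Mnu Nnu Nnu Q0 sQ QK K1 IM y1 hy1.
have za : abs zeta = 1 by rewrite stage_zetaE abs_expi.
have hQ : abs stage_dip.[zeta ^+ (I ^ 2) * y ^+ stage_nu] <= half ^+ (256 * u * (H + 3) + u + 1).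
  rewrite horner_exp absX.
  apply: le_trans (_ : (3 / 4) ^+ (s * u) <= _).
    apply: lerXn2r; rewrite ?nnegrE ?abs_ge0 //.
    by apply: dip_near => //; rewrite absM (abs_X1 _ za) (abs_X1 _ y1) mulr1.
  apply: le_trans (_ : (3 / 4) ^+ (4 * (256 * u * (H + 3) + u + 1)) <= _).
    apply: ler_wiXn2l; [lra | lra |].
    by rewrite /u; clear - sH f16; nia.
  rewrite exprM; apply: lerXn2r; rewrite ?nnegrE ?exprn_ge0 //; try lra.
have ht : stage_bound * (stage_nu%:R * (1 - ((8 * stage_M%:R)^-1) ^+ 2 / 4) ^+ stage_N)
    <= half ^+ (256 * u * (H + 3) + u + 1).
  have e1 : ((8 * stage_M%:R)^-1) ^+ 2 / 4 = half ^+ (24 * u + 8) :> R.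
    have -> : 8 * stage_M%:R = 2 ^+ (3 + 12 * u) :> R.
      by rewrite exprD /stage_M natrX; congr (_ * _); rewrite -natrX.
    rewrite -half_expE -exprM (_ : 4^-1 = half ^+ 2); last by field.
    by rewrite -exprD; congr (_ ^+ _); lia.
  rewrite e1 (_ : stage_N = 2 ^ ((24 * u + 8) + 12 * u))%N; last by rewrite /stage_N; congr (2 ^ _)%N; lia.
  have hx : 0 <= 1 - half ^+ (24 * u + 8).
    by rewrite subr_ge0 exprn_ile1 //; lra.
  have := expr_le_half (12 * u) hx (lexx _); set x := (_ ^+ (2 ^ _)) => hxx.
  apply: le_trans (_ : 2 ^+ (4 * u) * (2 ^+ (36 * u + 10) * half ^+ (2 ^ (12 * u))) <= _).
    by rewrite /stage_bound /stage_nu natrX !ler_pM2l ?exprn_gt0.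
  rewrite mulrA -exprD; apply: pow2_half.
  apply: leq_trans (_ : s * u <= _)%N; first by rewrite /u; clear - sH f16; nia.
  by apply: leq_trans sf _; rewrite leq_exp2l // /u; lia.
apply: le_trans (_ : 2 ^+ u * (half ^+ (256 * u * (H + 3) + u + 1) + half ^+ (256 * u * (H + 3) + u + 1)) <= _).
  by rewrite ler_pM2l ?exprn_gt0 // (le_trans h) // lerD.
rewrite -mulr2n -[X in 2 ^+ u * X]mulr_natl mulrA -exprSr; apply: pow2_half; lia.
Qed.

(** * Density of the good cells *)

Definition stage_cells := (2 ^ (255 * u))%N.
Let y0 (i : nat) : R[i] := expi (i%:R * (2 * pi / stage_cells%:R)).

(** Half of the tolerances of [stage_near] are imposed at the grid point [y0 i]; the other half
    absorbs the displacement of y in [stage_good_near]. *)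
Definition stage_good (i : nat) := exists2 I, (I < stage_M)%N &
  abs (y0 i - zeta ^+ I) <= (16 * stage_M%:R)^-1 /\
  abs (zeta ^+ (I ^ 2) * y0 i ^+ stage_nu - 1) <= s%:R^-1 / 4.

Lemma stage_good_near i y : stage_good i -> abs y = 1 ->
  abs (y - y0 i) <= half ^+ (62 * u) ->
  2 ^+ u * abs stage_poly.[y] <= half ^+ (256 * u * (H + 3)).
Proof.
case=> I IM [h1 h2] y1 hy; apply: (stage_near IM y1).
  apply: le_trans (abs_tri y (y0 i) _) _.
  have e16 : (16 * stage_M%:R)^-1 = half ^+ (12 * u + 4) :> R.
    rewrite half_expE exprD /stage_M natrX mulrC; congr (_ * _)^-1; by rewrite -natrX.
  have e8 : (8 * stage_M%:R)^-1 = (16 * stage_M%:R)^-1 + half ^+ (12 * u + 4) :> R.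
    by rewrite -e16; field; rewrite pnatr_eq0 -lt0n.
  rewrite e8 addrC; apply: lerD => //; apply: le_trans hy _.
  by apply: half_exp_le; rewrite /u; lia.
have za : abs zeta = 1 by rewrite stage_zetaE abs_expi.
have y0a : abs (y0 i) = 1 by rewrite abs_expi.
have E : zeta ^+ (I ^ 2) * y ^+ stage_nu - 1 =
  zeta ^+ (I ^ 2) * (y ^+ stage_nu - y0 i ^+ stage_nu) + (zeta ^+ (I ^ 2) * y0 i ^+ stage_nu - 1) by ring.
rewrite E; apply: le_trans (absD _ _) _; rewrite absM (abs_X1 _ za) mul1r.
have h3 : abs (y ^+ stage_nu - y0 i ^+ stage_nu) <= s%:R^-1 / 4.
  apply: le_trans (abs_subX _ y1 y0a) _.
  apply: le_trans (_ : 2 ^+ (36 * u + 10) * half ^+ (62 * u) <= _).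
    by rewrite /stage_nu natrX ler_pM2l ?exprn_gt0.
  apply: le_trans (_ : half ^+ (f + 2) <= _).
    by apply: pow2_half; rewrite /u; lia.
  have -> : half ^+ (f + 2) = (2 ^+ f)^-1 / 4 by rewrite exprD half_expE; field.
  rewrite ler_pM2r ?invr_gt0 // lef_pV2 ?posrE ?exprn_gt0 ?ltr0n //; last by case: s s4.
  rewrite -natrX ler_nat; apply: leq_trans sf; apply: leq_pmulr.
  by rewrite muln_gt0; case: f f16.
by move: h2 h3; move: (s%:R^-1) => t; lra.
Qed.

(** M J E indices are good, which is [stage_cells] divided by 2^14 s. The size of J is limited by
    closeness of y to zeta^I within 1/(16M), that of E by closeness of zeta^(I^2) y^nu to 1 within
    1/(4s). *)
Lemma stage_count : (stage_cells <= 2 ^ 14 * s * count (fun i => `[< stage_good i >]) (iota 0 stage_cells))%N.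
Proof.
have [sg hs] := sP.
have sgf : (sg <= f)%N.
  rewrite -(@leq_exp2l 2) // -hs; apply: leq_trans sf; apply: leq_pmulr.
  by rewrite muln_gt0; case: f f16.
pose q := (2 ^ (207 * u - 10))%N; pose J := (2 ^ (24 * u + 2))%N.
pose E := (2 ^ (219 * u - 16 - sg))%N.
have q0 : (0 < q)%N by rewrite expn_gt0.
have bE : stage_cells = (stage_M * (stage_nu * q))%N.
  by rewrite /stage_M /stage_nu /q -!expnD; congr (2 ^ _)%N; rewrite /u; lia.
have JJ : (J.+1 <= 2 ^ (24 * u + 3))%N.
  by rewrite /J ltn_exp2l //; lia.
have JM : (J.+1 * stage_M <= stage_nu)%N.
  apply: leq_trans (_ : 2 ^ (24 * u + 3) * stage_M <= _)%N; first by rewrite leq_mul2r JJ orbT.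
  by rewrite -expnD leq_exp2l //; lia.
have EM : (E <= stage_M * q)%N by rewrite -expnD leq_exp2l //; lia.
have main I j e : (I < stage_M)%N -> (j < J)%N -> (e < E)%N ->
    `[< stage_good (I * (stage_nu * q) + (j.+1 * stage_M - I ^ 2 %% stage_M) * q + e) >].
  move=> IM jJ eE; apply/asboolP; exists I => //.
  set r := (I ^ 2 %% stage_M)%N.
  have rM : (r < stage_M)%N by rewrite ltn_mod.
  have rjM : (r <= j.+1 * stage_M)%N by rewrite (leq_trans (ltnW rM)) // leq_pmull.
  set r0 := ((j.+1 * stage_M - r) * q + e)%N.
  have r0le : (r0 <= J.+1 * stage_M * q)%N.
    apply: leq_trans (_ : j.+1 * stage_M * q + stage_M * q <= _)%N.
      apply: leq_add; first by rewrite leq_mul2r leq_subr orbT.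
      exact: leq_trans (ltnW eE) EM.
    by rewrite -mulnDl -mulSnr leq_mul2r leq_mul2r ltnS jJ !orbT.
  have MR : stage_M%:R != 0 :> R by rewrite pnatr_eq0 -lt0n.
  have nuR : stage_nu%:R != 0 :> R by rewrite pnatr_eq0 -lt0n.
  have qR : q%:R != 0 :> R by rewrite pnatr_eq0 -lt0n.
  have bR : stage_cells%:R = stage_M%:R * (stage_nu%:R * q%:R) :> R by rewrite bE !natrM.
  have pi8 : 2 * pi <= 8 :> R by have := @pihalf_lt2 R; lra.
  have pi0 := @pi_gt0 R.
  rewrite stage_zetaE -addnA -/r0; split.
    rewrite expiX; apply: le_trans (expi_lip _ _) _.
    have -> : (I * (stage_nu * q) + r0)%:R * (2 * pi / stage_cells%:R) - I%:R * (2 * pi / stage_M%:R)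
        = r0%:R * (2 * pi) / stage_cells%:R :> R.
      by rewrite natrD !natrM bR; field; rewrite MR nuR qR.
    rewrite ger0_norm; last by rewrite divr_ge0 // mulr_ge0 // mulr_ge0 // ltW.
    apply: le_trans (_ : (2 ^ (24 * u + 3) * stage_M * q)%:R * 8 / stage_cells%:R <= _).
      rewrite ler_wpM2r ?invr_ge0 //; apply: ler_pM => //; first by rewrite mulr_ge0 // ltW.
      by rewrite ler_nat (leq_trans r0le) // !leq_mul2r JJ !orbT.
    rewrite bR !natrM natrX.
    have -> : 2 ^+ (24 * u + 3) * stage_M%:R * q%:R * 8 / (stage_M%:R * (stage_nu%:R * q%:R))
        = 2 ^+ (24 * u + 3) * 8 / stage_nu%:R :> R by field; rewrite MR nuR qR.
    rewrite ler_pdivrMr ?ltr0n // ler_pdivlMl ?mulr_gt0 ?ltr0n //.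
    have -> : 8 = 2 ^+ 3 :> R by rewrite -natrX.
    have -> : 16 = 2 ^+ 4 :> R by rewrite -natrX.
    rewrite /stage_M /stage_nu !natrX -!exprD le_eqVlt; apply/orP; left; apply/eqP.
    by congr (_ ^+ _); lia.
  rewrite !expiX -expiD.
  (* After multiplication by nu, the shift -(I^2 mod M) q cancels the fractional part of I^2/M,
     leaving m full turns and a small angle proportional to e. *)
  pose m := (I ^ 2 %/ stage_M + I * (stage_nu %/ stage_M) + j.+1)%N.
  have I2 : (I ^ 2)%:R = (I ^ 2 %/ stage_M)%:R * stage_M%:R + r%:R :> R.
    by rewrite -natrM -natrD -divn_eq.
  have nuM : stage_nu%:R = (stage_nu %/ stage_M)%:R * stage_M%:R :> R by rewrite -natrM divnK.
  have -> : (I ^ 2)%:R * (2 * pi / stage_M%:R) +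
      stage_nu%:R * ((I * (stage_nu * q) + r0)%:R * (2 * pi / stage_cells%:R))
      = m%:R * (2 * pi) + e%:R * (2 * pi) / (stage_M%:R * q%:R) :> R.
    rewrite bR natrD [r0%:R]natrD [((_ - _) * q)%:R]natrM natrB // I2 !natrM !natrD natrM.
    rewrite {1}nuM; move: nuR; rewrite nuM => nuR; field.
    by rewrite MR qR; move: nuR; rewrite mulf_eq0 negb_or => /andP[-> _].
  rewrite expiD expi_2piM mul1r -expi0; apply: le_trans (expi_lip _ _) _.
  rewrite subr0 ger0_norm; last by rewrite divr_ge0 ?mulr_ge0 // ltW.
  apply: le_trans (_ : E%:R * 8 / (stage_M%:R * q%:R) <= _).
    rewrite ler_wpM2r ?invr_ge0 ?mulr_ge0 //; apply: ler_pM => //; first by rewrite mulr_ge0 // ltW.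
    by rewrite ler_nat ltnW.
  rewrite ler_pdivrMr ?mulr_gt0 ?ltr0n // hs.
  have -> : 8 = 2 ^+ 3 :> R by rewrite -natrX.
  rewrite -mulrA ler_pdivlMl ?ltr0n ?expn_gt0 // ler_pdivlMl ?ltr0n //.
  have -> : 4 = 2 ^+ 2 :> R by rewrite -natrX.
  rewrite /E /stage_M /q !natrX -!exprD; apply: ler_weXn2l; first by lra.
  by rewrite /u; clear - sgf f16; lia.
have := count_grid (P := fun i => `[< stage_good i >]) q0 M0 JM EM main; rewrite -bE.
move: (count _ _) => c hc.
apply: leq_trans (_ : 2 ^ 14 * s * (stage_M * J * E) <= _)%N; last by rewrite leq_mul2l hc orbT.
rewrite hs /stage_cells /stage_M /J /E -!expnD leq_exp2l //.
by rewrite /u; clear - sgf f16; lia.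
Qed.

End Stage.

Lemma cube_le_exp2 n : (10 <= n)%N -> (n * n * n <= 2 ^ n)%N.
Proof.
move/subnKC <-; elim: (n - 10)%N => [|m IH] //.
rewrite addnS expnS; move: IH; move: (2 ^ _)%N => X; nia.
Qed.

(** * Choice of the sequences *)

Section Construction.
Variable R : realType.
Local Notation abs := (@Normc.normc R).
Local Notation half := (2^-1 : R).
Variable h : R -> R.
Hypothesis h_pos : forall t, 0 < t -> 0 < h t.
Hypothesis h_concave : concave_on_pos h.
Variable k0 : nat.

(** The offset k0 starts the geometric growth late enough for the dip widths to be small compared
    with 2^([radius_exp k]). *)
Definition radius_exp k := (256 ^ (k + k0))%N.
Definition freq_exp k := (4 * radius_exp k)%N.
Definition decay_order k := (Num.Def.truncn (h (freq_exp k)%:R)).+1.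
(** Of the order of h(e_(k+1)) up to an additive constant, rounded up to a power of two; its inverse
    is, up to a factor, the density killed at stage k. *)
Definition dip_width k := (2 ^ up_log 2 (1024 * (decay_order k.+1 + 5)))%N.

Hypothesis radius_exp_ge16 : forall k, (16 <= radius_exp k)%N.
Hypothesis dip_width_small : forall k, (dip_width k * (4 * radius_exp k) <= 2 ^ radius_exp k)%N.

Lemma radius_expS k : radius_exp k.+1 = (256 * radius_exp k)%N.
Proof. by rewrite /radius_exp addSn expnS. Qed.

Lemma freq_expS k : freq_exp k.+1 = (256 * freq_exp k)%N.
Proof. by rewrite /freq_exp radius_expS mulnCA. Qed.

Lemma freq_exp_gt0 k : (0 < freq_exp k)%N.
Proof. by rewrite /freq_exp muln_gt0 expn_gt0. Qed.

Lemma radius_exp_gt k : (k < radius_exp k)%N.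
Proof.
by elim: k => [|k IH]; [rewrite expn_gt0 | rewrite radius_expS; have := radius_exp_ge16 k; lia].
Qed.

Lemma decay_order_ge k : h (freq_exp k)%:R <= (decay_order k)%:R.
Proof. by rewrite ltW // truncnS_gt. Qed.

Lemma decay_order_le k : (decay_order k)%:R <= h (freq_exp k)%:R + 1.
Proof.
rewrite -natr1 lerD2r truncn_le ltW // h_pos // ltr0n; exact: freq_exp_gt0.
Qed.

Lemma decay_order_mono k : (decay_order k <= decay_order k.+1)%N.
Proof.
have e0 : 0 < (freq_exp k)%:R :> R by rewrite ltr0n freq_exp_gt0.
have hm : h (freq_exp k)%:R <= h (freq_exp k.+1)%:R.
  by apply: concave_pos_ndecr => //; rewrite ler_nat freq_expS leq_pmull.
rewrite /decay_order ltnS truncn_ge_nat; last by rewrite ltW // h_pos // ltr0n freq_exp_gt0.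
by apply: le_trans hm; rewrite truncn_le ltW // h_pos.
Qed.

Lemma dip_width_ge k : (1024 * (decay_order k.+1 + 5) <= dip_width k)%N.
Proof. exact: up_logP. Qed.

Lemma dip_width_le k : (dip_width k <= 2 ^ 11 * (decay_order k.+1 + 5))%N.
Proof.
have x1 : (1 < 1024 * (decay_order k.+1 + 5))%N by lia.
have /andP[] := up_log_bounds (isT : 1 < 2)%N x1; rewrite /dip_width.
case: (up_log _ _) => [|m] /=; first by move=> _ _; rewrite expn0; lia.
by rewrite expnS; move: (2 ^ m)%N => X; lia.
Qed.

Lemma dip_width_pow2 k : exists sg, dip_width k = (2 ^ sg)%N.
Proof. by eexists. Qed.

Definition freq k := (2 ^ freq_exp k)%N.
Definition gate_deg k := (2 ^ (freq_exp k - 3))%N.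
Definition grid_root k : R[i] := expi (2 * pi / (freq k)%:R).
Definition stage_phi k : {poly R[i]} := stage_poly R (radius_exp k) (dip_width k).
(** For 2 <= n <= 2^(e_k) this is at most e^(-omega(log n)); the extra 3 leaves room for a factor
    lam_k. *)
Definition tolerance k : R := half ^+ (freq_exp k * (decay_order k + 3)).
Definition radius k : R := half ^+ radius_exp k.
Definition prod_bound k : R := 2 ^+ freq_exp k.
Definition phi_bound k : R := 2 ^+ (4 * freq_exp k).

Lemma freq_gt0 k : (0 < freq k)%N. Proof. by rewrite expn_gt0. Qed.

Lemma prim_grid_root k : (freq k).-primitive_root (grid_root k).
Proof. exact: expi_prim (freq_gt0 k). Qed.

Lemma gate_deg_lt k : (gate_deg k < freq k)%N.
Proof. by rewrite ltn_exp2l //; have := freq_exp_gt0 k; lia. Qed.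

Lemma half_pos n : 0 < half ^+ n. Proof. by rewrite exprn_gt0 // invr_gt0. Qed.

Lemma gap_radius_ge k : half ^+ (radius_exp k + 1) <= gap radius k.
Proof.
have e : half ^+ radius_exp k = half ^+ (radius_exp k + 1) + half ^+ (radius_exp k + 1).
  by rewrite exprD expr1; lra.
rewrite /gap /radius e -addrA lerDl subr_ge0; apply: half_exp_le.
by rewrite radius_expS; have := radius_exp_ge16 k; lia.
Qed.

Lemma gap_radius_bounds k : 0 <= gap radius k <= 2.
Proof.
rewrite (le_trans (ltW (half_pos _)) (gap_radius_ge k)) /= /gap /radius.
have := half_pos (radius_exp k.+1); have : half ^+ radius_exp k <= 1 by rewrite exprn_ile1 //; lra.
lra.
Qed.

(** With f = [radius_exp k], the gap is at least 2^-(f + 1) and the gate degree is 2^(4f - 3), so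
    the tail is at most 2^-(2^(2f - 9)); and the required exponent is at most 2^f. *)
Lemma leak_radius_le k : leak gate_deg freq radius k <= 2 ^+ freq_exp k * half ^+ (dip_width k * freq_exp k).
Proof.
have e2 : (2 : R) ^+ freq_exp k = (freq k)%:R by rewrite natrX.
rewrite /leak e2 ler_pM2l ?ltr0n ?freq_gt0 //.
have g := gap_radius_ge k; have /andP[g0 g2] := gap_radius_bounds k.
have f16 := radius_exp_ge16 k.
rewrite (_ : gate_deg k = 2 ^ ((2 * radius_exp k + 6) + (2 * radius_exp k - 9)))%N; last first.
  by rewrite /gate_deg; congr (2 ^ _)%N; rewrite /freq_exp; lia.
apply: le_trans (_ : half ^+ (2 ^ (2 * radius_exp k - 9)) <= _); last first.
  apply: half_exp_le; apply: leq_trans (dip_width_small k) _.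
  by rewrite leq_exp2l //; lia.
apply: expr_le_half; first by nra.
rewrite lerD2l lerN2.
have e : half ^+ (2 * radius_exp k + 6) = (half ^+ (radius_exp k + 1) / 2) ^+ 2 / 4.
  rewrite expr_div_n -exprM (_ : (2 * radius_exp k + 6 = (radius_exp k + 1) * 2 + 4)%N); last by lia.
  by rewrite exprD; field.
rewrite e ler_pM2r ?invr_gt0 // lerXn2r ?nnegrE ?divr_ge0 ?(ltW (half_pos _)) //.
by rewrite ler_pM2r ?invr_gt0.
Qed.

Lemma pow2_leak_le k a c : (a + c + freq_exp k <= dip_width k * freq_exp k)%N ->
  2 ^+ a * leak gate_deg freq radius k <= half ^+ c.
Proof.
move=> hac; apply: le_trans (_ : 2 ^+ a * (2 ^+ freq_exp k * half ^+ (dip_width k * freq_exp k)) <= _).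
  by rewrite ler_pM2l ?exprn_gt0 // leak_radius_le.
by rewrite mulrA -exprD; apply: pow2_half; lia.
Qed.

Lemma stage_phi0 k : (stage_phi k)`_0 = 1.
Proof. exact: stage_coef0 (radius_exp_ge16 k) (dip_width_ge k) (dip_width_small k). Qed.

Lemma stage_phi_coef k m : (0 < m)%N -> abs (stage_phi k)`_m <= half ^+ k.
Proof.
move=> m0; apply: le_trans (stage_coef R (radius_exp_ge16 k) (dip_width_pow2 k) (dip_width_ge k) (dip_width_small k) m0) _.
by apply: half_exp_le; have := radius_exp_gt k; lia.
Qed.

Lemma stage_phi_le k z : abs z = 1 -> abs (stage_phi k).[z] <= phi_bound k.
Proof. exact: (stage_le (radius_exp_ge16 k) (dip_width_pow2 k) (dip_width_ge k) (dip_width_small k)). Qed.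

Lemma size_stage_phi k : (size (stage_phi k) <= 2 ^ (40 * freq_exp k))%N.
Proof. exact: (stage_size R (radius_exp_ge16 k) (dip_width_ge k) (dip_width_small k)). Qed.

Lemma shift_lt_freq k : ((freq_shift gate_deg k.+1).*2 < freq k)%N.
Proof.
have ex3 j : (3 < freq_exp j)%N by rewrite /freq_exp; have := radius_exp_ge16 j; lia.
have H j : (freq_shift gate_deg j.+1 <= 2 ^ (freq_exp j - 2))%N.
  elim: j => [|j IH]; rewrite freq_shiftS.
    by rewrite /freq_shift big_ord0 add0n leq_exp2l //; lia.
  apply: leq_trans (_ : 2 ^ (freq_exp j.+1 - 3) + 2 ^ (freq_exp j.+1 - 3) <= _)%N.
    rewrite leq_add2r; apply: leq_trans IH _; rewrite leq_exp2l // freq_expS.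
    by have := ex3 j; lia.
  rewrite addnn -mul2n -expnS leq_exp2l //; have := ex3 j.+1; lia.
apply: leq_ltn_trans (_ : 2 ^ (freq_exp k - 1) < _)%N; last first.
  by rewrite ltn_exp2l //; have := ex3 k; lia.
have -> : (freq_exp k - 1 = (freq_exp k - 2).+1)%N by have := ex3 k; lia.
by rewrite expnS -mul2n leq_mul2l H orbT.
Qed.

Lemma prod_boundS k : prod_bound k * phi_bound k <= prod_bound k.+1.
Proof. by rewrite /prod_bound /phi_bound -exprD; apply: ler_weXn2l; [lra | rewrite freq_expS; lia]. Qed.

Lemma prod_bound0_ge1 : 1 <= prod_bound 0. Proof. by rewrite exprn_ege1 // ler1n. Qed.

Lemma dip_width_mul_ge k : (1024 * (decay_order k.+1 + 5) * freq_exp k <= dip_width k * freq_exp k)%N.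
Proof. by rewrite leq_mul2r dip_width_ge orbT. Qed.

Lemma null_series_exists : exists c : int -> R[i],
  [/\ c 0 != 0,
      forall n k : nat, (freq_shift gate_deg k < n <= freq_shift gate_deg k.+1)%N ->
        abs (c (- n%:Z)) <= 4 * tolerance k
    & forall z, abs z = 1 -> (exists k, dead freq gate_deg freq grid_root stage_phi tolerance radius k z) ->
      forall e, 0 < e -> exists n0, forall n, (n0 <= n)%N ->
        abs (\sum_(j < n.*2.+1) c (j%:Z - n%:Z) * z ^+ j) <= e].
Proof.
have ex3 j : (64 <= freq_exp j)%N by rewrite /freq_exp; have := radius_exp_ge16 j; lia.
apply: (@lacunary_null_series R freq gate_deg freq grid_root stage_phi tolerance radius prod_bound phi_bound (fun k => half ^+ k)).
- exact: prim_grid_root.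
- exact: gate_deg_lt.
- exact: gap_radius_bounds.
- exact: stage_phi0.
- by move=> k m; exact: stage_phi_coef.
- by [].
- by move=> k z; exact: stage_phi_le.
- exact: prod_bound0_ge1.
- exact: prod_boundS.
- rewrite /gate_deg /freq -mul2n -expnS; apply: leq_trans (_ : 2 ^ (freq_exp 0 - 1) + 2 ^ (freq_exp 0 - 1) <= _)%N.
    apply: leq_add; first by rewrite expn_gt0.
    by rewrite leq_exp2l //; have := ex3 0%N; lia.
  by rewrite addnn -mul2n -expnS leq_exp2l //; have := ex3 0%N; lia.
- move=> k; rewrite /gate_deg /freq freq_expS -mul2n -expnS.
  apply: leq_trans (_ : 2 ^ (256 * freq_exp k - 1) + 2 ^ (256 * freq_exp k - 1) <= _)%N.
    apply: leq_add; last by rewrite leq_exp2l //; have := ex3 k; lia.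
    apply: leq_trans (leq_mul (size_stage_phi k) (leqnn _)) _.
    by rewrite -expnD leq_exp2l //; have := ex3 k; lia.
  by rewrite addnn -mul2n -expnS leq_exp2l //; have := ex3 k; lia.
- exact: shift_lt_freq.
- by move=> k; rewrite expn_gt0.
- move=> k; apply: pow2_leak_le; apply: leq_trans (dip_width_mul_ge k).
  by have := decay_order_mono k; have := ex3 k; move: (decay_order k) (decay_order k.+1) (freq_exp k) => a b c; nia.
- move=> k; rewrite /prod_bound /phi_bound mulrAC -exprD; apply: pow2_leak_le; apply: leq_trans (dip_width_mul_ge k).
  by rewrite freq_expS; have := ex3 k; move: (decay_order k.+1) (freq_exp k) => b c; nia.
- move=> k; apply: le_trans (_ : 2 ^+ (40 * freq_exp k) * (prod_bound k * leak gate_deg freq radius k) <= _).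
    rewrite ler_wpM2r //; last by rewrite -natrX ler_nat size_stage_phi.
    rewrite mulr_ge0 ?exprn_ge0 // mulr_ge0 // exprn_ge0 //.
    by have := gap_radius_bounds k; nra.
  rewrite /prod_bound mulrA -exprD; apply: pow2_leak_le; apply: leq_trans (dip_width_mul_ge k).
  have : (k <= freq_exp k)%N by rewrite /freq_exp; have := radius_exp_gt k; lia.
  by move: (decay_order k.+1) (freq_exp k) => b c; nia.
- move=> k; rewrite /freq /tolerance natrX; apply: pow2_half.
  have : (k <= freq_exp k)%N by rewrite /freq_exp; have := radius_exp_gt k; lia.
  by move: (decay_order k) (freq_exp k) => b c; nia.
- move=> k; rewrite /tolerance -exprSr; apply: half_exp_le.
  rewrite freq_expS; have := decay_order_mono k; have := ex3 k.
  by move: (decay_order k) (decay_order k.+1) (freq_exp k) => a b c; nia.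
- rewrite (_ : 8^-1 = half ^+ 3); last by field.
  by apply: half_exp_le; have := ex3 0%N; move: (decay_order 0%N) (freq_exp 0%N) => a c; nia.
- by move=> k; rewrite ltW // half_pos.
Qed.

(** * Almost every point is eventually killed *)

Definition good_point k (t : R) := forall z', abs z' = 1 -> abs (z' - expi t) <= radius k.+1 ->
  prod_bound k * abs (stage_phi k).[z' ^+ freq k] <= tolerance k.+1.

Lemma good_point_dead k t : good_point k t -> dead freq gate_deg freq grid_root stage_phi tolerance radius k.+1 (expi t).
Proof.
exact: (zone_dead prim_grid_root gate_deg_lt stage_phi_le prod_bound0_ge1 prod_boundS (abs_expi t)).
Qed.

Definition subcells k := stage_cells (radius_exp k).
Definition bad_subcells k := [seq i <- iota 0 (subcells k) | ~~ `[< stage_good R (radius_exp k) (dip_width k) i >]].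
Definition kill_ratio k : R := (2 ^+ 14 * (dip_width k)%:R)^-1.

Lemma dip_width_gt0 k : (0 < dip_width k)%N. Proof. by rewrite expn_gt0. Qed.

Lemma size_bad_subcells k : (size (bad_subcells k))%:R <= (subcells k)%:R * (1 - kill_ratio k).
Proof.
have hc := stage_count R (radius_exp_ge16 k) (dip_width_pow2 k) (dip_width_ge k) (dip_width_small k).
rewrite size_filter; set P := fun i => `[< stage_good R (radius_exp k) (dip_width k) i >] in hc *.
have e := count_predC P (iota 0 (subcells k)); rewrite size_iota in e.
have -> : (subcells k)%:R = (count P (iota 0 (subcells k)))%:R + (count (predC P) (iota 0 (subcells k)))%:R :> R.
  by rewrite -natrD e.
rewrite mulrBr mulr1 -natrD e lerBrDr -lerBrDl.
have -> : (subcells k)%:R - (count (predC P) (iota 0 (subcells k)))%:R = (count P (iota 0 (subcells k)))%:R :> R.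
  by rewrite -{1}e natrD addrK.
rewrite /kill_ratio ler_pdivrMr ?mulr_gt0 ?exprn_gt0 ?ltr0n ?dip_width_gt0 //.
by rewrite -natrX -!natrM ler_nat mulnC.
Qed.

(** Raising to the power lam_k drops i full turns, so only the index i' within the coarser cell
    matters. The cell width and the radius, multiplied by lam_k, together stay below 2^-(62 e_k). *)
Lemma good_point_cell k i i' t : (i' < subcells k)%N -> i' \notin bad_subcells k ->
  cell freq k.+1 (i * subcells k + i') t -> good_point k t.
Proof.
move=> ib; rewrite /bad_subcells mem_filter mem_iota /= add0n ib andbT negbK => /asboolP hg.
rewrite /cell /= in_itv /= => /andP[t1 t2] z' z'1 hz'.
have lamS : freq k.+1 = (freq k * subcells k)%N.
  by rewrite /freq /subcells /stage_cells -expnD freq_expS /freq_exp; congr (2 ^ _)%N; lia.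
rewrite /prod_bound /tolerance freq_expS.
apply: (stage_good_near (radius_exp_ge16 k) (dip_width_pow2 k) (dip_width_ge k) (dip_width_small k) hg); first by rewrite abs_X1.
pose x : R := (i * subcells k + i')%:R * (2 * pi / (freq k.+1)%:R).
have l0 : (freq k)%:R != 0 :> R by rewrite pnatr_eq0 -lt0n freq_gt0.
have b0 : (subcells k)%:R != 0 :> R by rewrite pnatr_eq0 -lt0n expn_gt0.
have -> : expi (i'%:R * (2 * pi / (stage_cells (radius_exp k))%:R)) = expi x ^+ freq k.
  rewrite expiX -/(subcells k) /x lamS natrM.
  have -> : (freq k)%:R * ((i * subcells k + i')%:R * (2 * pi / ((freq k)%:R * (subcells k)%:R)))
     = i%:R * (2 * pi) + i'%:R * (2 * pi / (subcells k)%:R) :> R.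
    by rewrite natrD natrM; field; rewrite l0 b0.
  by rewrite expiD expi_2piM mul1r.
apply: le_trans (abs_subX _ z'1 (abs_expi x)) _.
have hx : abs (z' - expi x) <= half ^+ (64 * freq_exp k) + half ^+ (64 * freq_exp k).
  apply: le_trans (abs_tri _ (expi t) _) _; apply: lerD.
    by apply: le_trans hz' _; apply: half_exp_le; rewrite radius_expS /freq_exp; lia.
  apply: le_trans (expi_lip _ _) _.
  have : `|t - x| <= 2 * pi / (freq k.+1)%:R.
    rewrite ger0_norm ?subr_ge0 // lerBlDr.
    by apply: le_trans t2 _; rewrite -natr1 mulrDl mul1r addrC.
  move/le_trans; apply.
  have pi8 : 2 * pi <= 2 ^+ 3 :> R.
    by have := @pihalf_lt2 R; rewrite (_ : 2 ^+ 3 = 8 :> R); [lra | rewrite -natrX].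
  apply: le_trans (_ : 2 ^+ 3 * half ^+ freq_exp k.+1 <= _).
    by rewrite /freq natrX -half_expE ler_pM2r // half_pos.
  by apply: pow2_half; rewrite freq_expS; have := freq_exp_gt0 k; rewrite /freq_exp; have := radius_exp_ge16 k; lia.
apply: le_trans (_ : 2 ^+ freq_exp k * (half ^+ (64 * freq_exp k) + half ^+ (64 * freq_exp k)) <= _).
  by rewrite /freq natrX ler_pM2l ?exprn_gt0.
rewrite -mulr2n -[X in _ * X]mulr_natl mulrA -exprSr; apply: pow2_half.
by rewrite -/(freq_exp k); have := freq_exp_gt0 k; lia.
Qed.

Hypothesis h_div :
  ((fun N : nat => \sum_(0 <= k < N) (k.+1%:R * h k.+1%:R)^-1) @ \oo --> +oo)%classic.

(** The dip width is at most a constant times h(e_(k+1)), the additive constants being absorbed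
    through h >= h(1) > 0 beyond 1; condensation along e_(k+1) gives divergence. *)
Lemma kill_ratio_div (A : R) : exists n, A <= \sum_(k < n) kill_ratio k.
Proof.
have h1 := h_pos ltr01.
pose c : R := (2 ^+ 14 * (2 ^+ 11 * (1 + 6 / h 1)))^-1.
have q0 : 0 < 1 + 6 / h 1 by rewrite addr_gt0 // divr_gt0.
have p14 : 0 < 2 ^+ 14 :> R by rewrite exprn_gt0.
have p11 : 0 < 2 ^+ 11 :> R by rewrite exprn_gt0.
have c0 : 0 < c by rewrite invr_gt0 mulr_gt0 // mulr_gt0.
have dc k : c * (h (freq_exp k.+1)%:R)^-1 <= kill_ratio k.
  have e0 : 0 < (freq_exp k.+1)%:R :> R by rewrite ltr0n freq_exp_gt0.
  have hk := h_pos e0; have s0 : 0 < (dip_width k)%:R :> R by rewrite ltr0n dip_width_gt0.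
  rewrite /c /kill_ratio -invfM lef_pV2 ?posrE; [|by rewrite mulr_gt0 ?mulr_gt0|by rewrite mulr_gt0 ?mulr_gt0 ?mulr_gt0].
  rewrite -[leRHS]mulrA ler_pM2l // -[leRHS]mulrA.
  apply: le_trans (_ : 2 ^+ 11 * ((decay_order k.+1)%:R + 5) <= _).
    by rewrite -natrX -natrD -natrM ler_nat dip_width_le.
  rewrite ler_pM2l // mulrDl mul1r; have := decay_order_le k.+1.
  have : 6 <= 6 / h 1 * h (freq_exp k.+1)%:R.
    rewrite mulrAC ler_pdivlMr // ler_pM2l //; apply: concave_pos_ndecr => //.
    by rewrite ler1n freq_exp_gt0.
  lra.
have exx k : (freq_exp k.+1 < freq_exp k.+2 <= 257 * freq_exp k.+1)%N.
  by rewrite [freq_exp k.+2]freq_expS; have := freq_exp_gt0 k.+1; lia.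
have [n hn] := @condensation R h h_pos h_concave (fun k => freq_exp k.+1) (fun k => freq_exp_gt0 k.+1)
  exx h_div (A / c).
exists n; move: hn; rewrite ler_pdivrMr // => /le_trans; apply.
by rewrite mulr_suml; apply: ler_sum => k _; rewrite mulrC.
Qed.

Lemma ae_good_point : {ae (@lebesgue_measure R), forall t : R,
  t \in `[0, 2 * pi]%R -> exists k, good_point k t}.
Proof.
apply: (@ae_good R freq subcells bad_subcells kill_ratio).
- exact: freq_gt0.
- by move=> k; rewrite /freq /subcells /stage_cells -expnD freq_expS /freq_exp; congr (2 ^ _)%N; lia.
- move=> k; have s1 : 1 <= 2 ^+ 14 * (dip_width k)%:R :> R.
    by rewrite mulr_ege1 ?exprn_ege1 ?ler1n ?dip_width_gt0.
  by rewrite /kill_ratio invr_ge0 (le_trans ler01 s1) /= invf_le1 // (lt_le_trans ltr01).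
- exact: size_bad_subcells.
- exact: kill_ratio_div.
- exact: good_point_cell.
Qed.

End Construction.

(** * Choice of the starting stage and conclusion *)

(** Since h grows at most linearly, the left side is at most C f^2 with f = [radius_exp k0 k];
    starting with f >= C gives C f^2 <= f^3 <= 2^f. *)
Lemma stage_exponent_bound (R : realType) (h : R -> R) :
  (forall t, 0 < t -> 0 < h t) -> concave_on_pos h ->
  exists k0, (forall k, (16 <= radius_exp k0 k)%N) /\
    forall k, (dip_width h k0 k * (4 * radius_exp k0 k) <= 2 ^ radius_exp k0 k)%N.
Proof.
move=> h_pos h_concave; have h1 := h_pos _ ltr01.
pose c := (Num.Def.truncn (2 * h 1)).+1.
have hc : 2 * h 1 <= c%:R by rewrite ltW // truncnS_gt.
pose C := (2048 * 4 * (1024 * c + 6))%N.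
exists C.+1 => /=.
have fC k : (C <= radius_exp C.+1 k)%N.
  rewrite /radius_exp; apply: leq_trans (_ : 256 ^ C <= _)%N; first by rewrite ltnW // ltn_expl.
  by rewrite leq_exp2l //; lia.
have f16 k : (16 <= radius_exp C.+1 k)%N.
  rewrite /radius_exp addnS expnS; apply: leq_trans (_ : 256 * 1 <= _)%N => //.
  by rewrite leq_mul2l expn_gt0.
split=> // k; apply: leq_trans (cube_le_exp2 (leq_trans _ (f16 k))) => //.
have hhc : (decay_order h C.+1 k.+1 <= 1024 * c * radius_exp C.+1 k + 1)%N.
  rewrite -(ler_nat R); apply: le_trans (decay_order_le h_pos _ _) _.
  rewrite natrD lerD2r; have e1 : 1 <= (freq_exp C.+1 k.+1)%:R :> R by rewrite ler1n freq_exp_gt0.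
  apply: le_trans (concave_pos_linear h_pos h_concave e1) _.
  apply: le_trans (_ : c%:R * (freq_exp C.+1 k.+1)%:R <= _); first by rewrite ler_wpM2r.
  rewrite -natrM ler_nat freq_expS /freq_exp; lia.
have sl := dip_width_le h C.+1 k.
move: sl hhc (fC k) (f16 k).
move: (dip_width h C.+1 k) (decay_order h C.+1 k.+1) (radius_exp C.+1 k) => a b f; rewrite /C; move: (c) => d.
rewrite (_ : 2 ^ 11 = 2048)%N // => h2 h3 h4 h5.
have h6 : (a <= 2048 * (1024 * d * f + 6 * f))%N by lia.
have h7 : (a * (4 * f) <= 2048 * (1024 * d * f + 6 * f) * (4 * f))%N by rewrite leq_mul2r h6 orbT.
apply: leq_trans h7 _.
have -> : (2048 * (1024 * d * f + 6 * f) * (4 * f) = 2048 * 4 * (1024 * d + 6) * f * f)%N by lia.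
by rewrite !leq_mul2r h4 !orbT.
Qed.

Local Open Scope classical_set_scope.
Local Open Scope ring_scope.

Theorem theorem3 (R : realType) (omega : R -> R)
  (omega_pos : forall t : R, 0 < t -> 0 < omega t)
  (omega_concave : concave_on_pos (fun t => omega t / t))
  (omega_div : (fun N : nat => \sum_(0 <= k < N) (omega k.+1%:R)^-1)
                 @ \oo --> +oo) :
  exists a b : int -> R,
    (exists n : int, a n != 0 \/ b n != 0) /\
    {ae (@lebesgue_measure R), forall t : R, t \in `[0, 2 * pi] ->
        (psum_re a b ^~ t @ \oo --> 0) /\ (psum_im a b ^~ t @ \oo --> 0)} /\
    (exists (C : R) (N0 : nat), forall n : nat, (N0 <= n)%N ->
        cmod a b (- n%:Z) <= C * expR (- omega (ln n%:R))).
Proof.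
pose h t := omega t / t.
have h_pos t : 0 < t -> 0 < h t by move=> t0; rewrite divr_gt0 // omega_pos.
have omegaE t : 0 < t -> omega t = t * h t.
  by move=> t0; rewrite /h mulrCA divff ?mulr1 // gt_eqF.
have h_div : (fun N : nat => \sum_(0 <= k < N) (k.+1%:R * h k.+1%:R)^-1) @ \oo --> +oo.
  rewrite (_ : (fun _ => _) = (fun N : nat => \sum_(0 <= k < N) (omega k.+1%:R)^-1)) //.
  by apply/funext => N; apply: eq_bigr => k _; rewrite omegaE // ltr0n.
have [k0 [f16 sf]] := stage_exponent_bound h_pos omega_concave.
have [c [c0 cneg cconv]] := null_series_exists h_pos omega_concave f16 sf.
pose a n := complex.Re (c n); pose b n := complex.Im (c n).
exists a, b; split.
  exists 0; apply/orP; rewrite -negb_and; apply: contra c0 => /andP[/eqP a0 /eqP b0].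
  by rewrite eq_complex /= -/(a 0) -/(b 0) a0 b0 eqxx.
split.
  have := ae_good_point h_pos omega_concave f16 sf h_div.
  apply: negligibleS => t /= nP Q; apply: nP => /Q [k gk].
  have dk : exists k, dead (freq k0) (gate_deg k0) (freq k0) (grid_root R k0) (stage_phi h k0)
      (tolerance h k0) (radius R k0) k (expi t).
    have gd := good_point_dead f16 sf gk; by exists k.+1.
  (* Factoring out e^(-iNt), of modulus 1, gives the symmetric sum the form treated by [cconv]. *)
  have sumE N : \sum_(j < N.*2.+1) c (j%:Z - N%:Z) * expi ((j%:Z - N%:Z)%:~R * t)
      = expi (- (N%:R * t)) * \sum_(j < N.*2.+1) c (j%:Z - N%:Z) * expi t ^+ j.
    rewrite mulr_sumr; apply: eq_bigr => j _; rewrite mulrCA expiX -expiD; congr (_ * expi _).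
    by rewrite intrB !pmulrn; ring.
  have reE N : psum_re a b N t =
      complex.Re (\sum_(j < N.*2.+1) c (j%:Z - N%:Z) * expi ((j%:Z - N%:Z)%:~R * t)).
    rewrite /psum_re; elim/big_rec2: _ => // j x y _ ->.
    by rewrite /a /b; case: (c _) => p q; case: x.
  have imE N : psum_im a b N t =
      complex.Im (\sum_(j < N.*2.+1) c (j%:Z - N%:Z) * expi ((j%:Z - N%:Z)%:~R * t)).
    rewrite /psum_im; elim/big_rec2: _ => // j x y _ ->.
    by rewrite /a /b; case: (c _) => p q; case: x.
  have main (e : R) : 0 < e -> exists n0, forall n, (n0 <= n)%N ->
     Normc.normc (\sum_(j < n.*2.+1) c (j%:Z - n%:Z) * expi ((j%:Z - n%:Z)%:~R * t)) <= e.
    move=> e0; have [n0 hn0] := cconv (expi t) (abs_expi t) dk e e0.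
    by exists n0 => n hn; rewrite sumE absM abs_expi mul1r hn0.
  split; apply/cvgrPdist_le => e e0; have [n0 hn0] := main e e0; exists n0 => // n /= hn.
    by rewrite sub0r normrN reE; apply: le_trans (abs_Re _) (hn0 n hn).
  by rewrite sub0r normrN imE; apply: le_trans (abs_Im _) (hn0 n hn).
(* The constant 4 is that of [cneg]; n >= 2 makes log n positive, so that omega(log n) = log n *
   h(log n). *)
exists 4, 2%N => n n2.
have cE : cmod a b (- n%:Z) = Normc.normc (c (- n%:Z)).
  by rewrite /cmod /a /b; case: (c _).
rewrite cE.
have [k hk] : exists k, (freq_shift (gate_deg k0) k < n <= freq_shift (gate_deg k0) k.+1)%N.
  have sk k : (k <= freq_shift (gate_deg k0) k)%N.
    elim: k => // k IH; rewrite freq_shiftS; have : (0 < gate_deg k0 k)%N by rewrite expn_gt0.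
    by move: (gate_deg _ _) (freq_shift _ _) IH => x y; lia.
  have exP : exists k, (n <= freq_shift (gate_deg k0) k)%N by exists n.
  case: (ex_minnP exP) => -[|k] hk kmin.
    by move: hk; rewrite /freq_shift big_ord0; lia.
  exists k; rewrite hk andbT ltnNge; apply/negP => /kmin; lia.
apply: le_trans (cneg n k hk) _; rewrite ler_pM2l //.
have nR : 1 < n%:R :> R by rewrite ltr1n.
have ln0 : 0 < ln n%:R :> R by rewrite ln_gt0.
(* The frequency -n first appears through the gate of stage k, so n <= lam_k and log n <= e_k log 2
   <= e_k; monotonicity of h then bounds omega(log n). *)
have nl : (n <= freq k0 k)%N.
  by have := shift_lt_freq f16 k; case/andP: hk; lia.
have l2 : ln n%:R <= (freq_exp k0 k)%:R * ln 2 :> R.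
  rewrite mulr_natl -lnXn // ler_ln ?posrE ?exprn_gt0 //; last by rewrite (lt_trans ltr01).
  by rewrite -natrX ler_nat.
have ln2 : ln 2 <= 1 :> R.
  by have := @le_ln1Dx R 1; rewrite (_ : 1 + 1 = 2) //; apply; lra.
have ln20 : 0 < ln 2 :> R by rewrite ln_gt0 // ltr1n.
have e0 : 0 < (freq_exp k0 k)%:R :> R by rewrite ltr0n freq_exp_gt0.
have hle : h (ln n%:R) <= (decay_order h k0 k)%:R.
  apply: le_trans (decay_order_ge h k0 k).
  apply: (concave_pos_ndecr h_pos omega_concave) => //.
  by apply: le_trans l2 _; rewrite ler_piMr // ltW.
have om : omega (ln n%:R) <= (freq_exp k0 k)%:R * ln 2 * ((decay_order h k0 k)%:R + 3).
  rewrite omegaE //; apply: ler_pM => //; rewrite ?ltW ?h_pos //.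
  by apply: le_lt_trans hle _; rewrite ltrDl.
have -> : tolerance h k0 k = expR (- ((freq_exp k0 k)%:R * ln 2 * ((decay_order h k0 k)%:R + 3))).
  rewrite /tolerance half_expE expRN; congr (_^-1).
  by rewrite mulrAC -natrD -natrM expRM_natl lnK ?posrE.
by rewrite ler_expR lerN2.
Qed.
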